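(* Let $p$ be a polynomial over $\mathbb{C}$ with $\deg(p)\geq 2$ and let $P:\mathcal{M}(2,\mathbb{C})\to\mathcal{M}(2,\mathbb{C})$ be the corresponding matrix-valued polynomial. Then the Julia set $J_P$ of $P$ satisfies $$J_P=\partial\overline{K_P}=\{Q[\lambda_1,\lambda_2]Q^{-1}: (\lambda_1,\lambda_2)\in (K_p\times J_p)\cup (J_p\times K_p),\ Q\in \mathrm{GL}(2,\mathbb{C})\}\ \cup\ \{Q[\lambda]Q^{-1}:\lambda\in J_p,\ Q\in \mathrm{GL}(2,\mathbb{C})\}.$$
   Context: $\mathcal{M}(2,\mathbb{C})\cong\mathbb{C}^4$ is the space of $2\times 2$ complex matrices. For a polynomial $p(z)=a_kz^k+\cdots+a_1z+a_0$ over $\mathbb{C}$, the corresponding matrix-valued polynomial is $P(M)=a_kM^k+\cdots+a_1M+a_0\mathrm{Id}$. Superscripts $p^r$, $P^r$ denote $r$-fold iterates. $[\lambda_1,\lambda_2]=\begin{pmatrix}\lambda_1&0\\0&\lambda_2\end{pmatrix}$ and $[\lambda]=\begin{pmatrix}\lambda&1\\0&\lambda\end{pmatrix}$. $K_p=\{z\in\mathbb{C}:\{p^r(z)\}_{r\ge1}\text{ is bounded}\}$, $J_p=\partial K_p$, and $K_P=\{M\in\mathcal{M}(2,\mathbb{C}):\{P^r(M)\}_{r\ge1}\text{ is bounded}\}$. The Fatou set $F_P$ is the set of $M\in\mathcal{M}(2,\mathbb{C})$ having a neighborhood on which $\{P^n\}_{n\ge1}$ is a normal family, meaning that every sequence from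 the family has a subsequence which either converges uniformly on compact subsets to a holomorphic map or diverges uniformly on compact subsets to infinity. The Julia set is $J_P=\mathcal{M}(2,\mathbb{C})\setminus F_P$. Closures and boundaries are taken in $\mathcal{M}(2,\mathbb{C})\cong\mathbb{C}^4$ (respectively in $\mathbb{C}$ for subsets of $\mathbb{C}$). *)

(* Defs.v *)
From HB Require Import structures.
From mathcomp Require Import all_boot all_order all_algebra complex.
From mathcomp Require Import all_classical all_reals all_analysis.
Export numFieldNormedType.Exports.

Set Implicit Arguments.
Unset Strict Implicit.
Unset Printing Implicit Defensive.

Import Order.TTheory GRing.Theory Num.Theory.

Local Open Scope classical_set_scope.
Local Open Scope ring_scope.

(* [R[i]] packaged behind a [numClosedFieldType]: the norm-induced topology of
   [numFieldNormedType.Exports] is found from the head [Num.ClosedField.sort],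
   not from the bare type [R[i]]. *)
Definition Cplx (R : realType) : numClosedFieldType := R[i].

Notation M2 R := 'M[Cplx R]_2.

Definition boundary (T : topologicalType) (A : set T) : set T :=
  closure A `\` interior A.

(* The differential in [differentiable] is [K]-linear, so for [K := Cplx R] this
   is complex Frechet differentiability, i.e. holomorphy when [U] is open. *)
Definition holomorphic_on (K : numFieldType) (V W : normedModType K)
    (U : set V) (f : V -> W) : Prop :=
  forall x, U x -> differentiable f x.

Section Normality.
Variables (K : numFieldType) (V W : normedModType K).

Definition cvg_unif_on_compacts (U : set V) (f : nat -> V -> W) (g : V -> W) :
    Prop :=
  forall C : set V, compact C -> C `<=` U -> {uniform C, f @ \oo --> g}.

(* [A \is Num.real] because the order of [Cplx R] is only partial. *)
Definition diverges_unif_on_compacts (U : set V) (f : nat -> V -> W) : Prop :=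
  forall C : set V, compact C -> C `<=` U ->
  forall A : K, A \is Num.real ->
    \forall n \near \oo, forall x, C x -> A < `|f n x|.

Definition normal_family (U : set V) (F : set (V -> W)) : Prop :=
  forall u : nat -> V -> W, (forall n, F (u n)) ->
  exists s : nat -> nat, {homo s : m n / (m < n)%N} /\
    ((exists g : V -> W, holomorphic_on U g /\
        cvg_unif_on_compacts U (u \o s) g) \/
     diverges_unif_on_compacts U (u \o s)).

End Normality.

Section Dynamics.
Variable R : realType.
Implicit Types (p : {poly Cplx R}) (l : Cplx R).

Definition filled_julia p : set (Cplx R) :=
  [set z | bounded_set [set iter r (horner p) z | r in [set r | (1 <= r)%N]]].

Definition julia p : set (Cplx R) := boundary (filled_julia p).

Definition mx_poly p (M : M2 R) : M2 R := horner_mx M p.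

Definition mx_filled_julia p : set (M2 R) :=
  [set M | bounded_set [set iter r (mx_poly p) M | r in [set r | (1 <= r)%N]]].

Definition mx_fatou p : set (M2 R) :=
  [set M | exists U : set (M2 R), open_nbhs M U /\
     normal_family U [set iter n (mx_poly p) | n in [set n | (1 <= n)%N]]].

Definition mx_julia p : set (M2 R) := ~` mx_fatou p.

Definition diag2 l1 l2 : M2 R := \matrix_(i, j)
  if i == j then (if i == 0 then l1 else l2) else 0.

Definition jordan2 l : M2 R := \matrix_(i, j)
  if i == j then l else if i == 0 then 1 else 0.

Definition mx_julia_diag p : set (M2 R) :=
  [set M | exists l1 l2 (Q : M2 R),
     ((filled_julia p `*` julia p) `|` (julia p `*` filled_julia p)) (l1, l2) /\
     Q \in unitmx /\ M = Q *m diag2 l1 l2 *m invmx Q].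

Definition mx_julia_jordan p : set (M2 R) :=
  [set M | exists l (Q : M2 R),
     julia p l /\ Q \in unitmx /\ M = Q *m jordan2 l *m invmx Q].

End Dynamics.

(* Main.v *)
(** Write [E] for the matrices all of whose eigenvalues lie in [K_p]; then [closure K_P = E],
    and the interior of [E] consists of the matrices with all eigenvalues in the interior of
    [K_p].  Everything rests on [q(M) = q(a) + q[a, b] (M - a)], where [a], [b] are the
    eigenvalues of [M] and [q[a, b]] is a divided difference.  Over the interior of [E], Cauchy's
    estimate makes [q[a, b]], hence the iterates of [P], locally bounded, so Montel's theorem
    applies; off [E] an eigenvalue escapes and the iterates diverge.  Near a point of the boundary
    of [E] there are both bounded and escaping orbits, so the family is not normal there. *)
Require Import Defs.
From HB Require Import structures.
From mathcomp Require Import all_boot all_order all_algebra complex.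
From mathcomp Require Import ring cyclic separable cyclotomic.
From mathcomp Require Import all_classical all_reals all_analysis.

Set Implicit Arguments.
Unset Strict Implicit.
Unset Printing Implicit Defensive.

Import Order.TTheory GRing.Theory Num.Theory.

Local Open Scope classical_set_scope.
Local Open Scope ring_scope.

(** * Polynomial estimates *)

Section PolynomialEstimates.
Variable C : numClosedFieldType.
Implicit Types (q : {poly C}) (B K r t z : C).

(** The two eigenvalues cannot be chosen continuously in [M]. One eigenvalue [a] is therefore picked
    for each matrix separately, the other is [\tr M - a], and continuity enters only through trace
    and determinant. A double eigenvalue is the delicate case: the divided difference is then the
    derivative of an iterate at [a], which may be unbounded in [n], so [K_P] can be smaller than
    [E]. Taking the closure repairs this because [K_p] has no isolated point: an arbitrarily small
    perturbation splits the double eigenvalue inside [K_p]. Since all iterates are polynomials, the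
    analysis reduces to finite algebra: Cauchy's estimates are averages over roots of unity, and the
    existence of a zero in a disc comes from comparing finite products. *)

Lemma prim_root_exists n : (0 < n)%N -> exists z : C, n.-primitive_root z.
Proof.
move=> n0; have [s Ds] := closed_field_poly_normal ('X^n - 1 : {poly C}).
rewrite (monicP _) ?monicXnsubC // scale1r in Ds.
have s1 : all n.-unity_root s.
  by apply/allP => z; rewrite -root_prod_XsubC -Ds.
have szs : (n < (size s).+1)%N.
  by rewrite -(size_prod_XsubC s id) -Ds size_XnsubC.
have [|z _ zn] := hasP (has_prim_root n0 s1 _ szs); last by exists z.
by rewrite -separable_prod_XsubC -Ds separable_Xn_sub_1 // pnatr_eq0 -lt0n.
Qed.

Lemma sum_prim_root n z k : n.-primitive_root z ->
  \sum_(i < n) (z ^+ k) ^+ i = if (n %| k)%N then n%:R else 0.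
Proof.
move=> zn; case: ifPn => [nk|nk].
  rewrite (eq_bigr (fun=> 1)) ?sumr_const ?card_ord// => i _.
  by rewrite (eqP (_ : z ^+ k == 1)) ?expr1n// -(prim_order_dvd zn).
have zk1 : z ^+ k - 1 != 0 by rewrite subr_eq0 -(prim_order_dvd zn).
apply: (mulfI zk1); rewrite mulr0 -subrX1 -exprM mulnC exprM.
by rewrite (prim_expr_order zn) expr1n subrr.
Qed.

Lemma norm_prim_root n z : n.-primitive_root z -> `|z| = 1.
Proof.
move=> zn; have n0 := prim_order_gt0 zn.
by apply: (pexpIrn n0); rewrite ?nnegrE// -normrX (prim_expr_order zn) normr1 expr1n.
Qed.

(* Cauchy's estimate, with the contour integral replaced by an average over
   sufficiently many roots of unity. *)
Lemma coef_circle_bound q B r k : 0 <= r ->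
  (forall t, `|t| = r -> `|q.[t]| <= B) -> `|q`_k| * r ^+ k <= B.
Proof.
(* With [n] above [k] and at least the size of [q], no other exponent is congruent to [k] modulo
   [n]. *)
move=> r0 qB; pose n := maxn (size q) k.+1.
have n0 : (0 < n)%N by rewrite /n leq_max orbT.
have kn : (k < n)%N by rewrite /n leq_max leqnn orbT.
have [z zn] := prim_root_exists n0.
(* The exponent [n - k] plays the role of [-k]: the sum over [i] survives only when [n] divides
   [j + (n - k)], that is, when [j = k]. *)
have nE : \sum_(i < n) q.[r * z ^+ i] * z ^+ (i * (n - k)) = n%:R * (q`_k * r ^+ k).
  under eq_bigr => i _.
    rewrite (horner_coef_wide _ (leq_maxl _ _ : (size q <= n)%N)) mulr_suml.
    under eq_bigr => j _ do
      rewrite exprMn -!exprM -!mulrA -exprD -mulnDr mulnC exprM mulrA.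
    over.
  rewrite exchange_big /= (bigD1 (Ordinal kn)) //= [X in _ + X]big1 => [|j jk].
    rewrite addr0 -mulr_sumr (sum_prim_root _ zn) subnKC ?(ltnW kn)// dvdnn mulrC.
    by [].
  rewrite -mulr_sumr (sum_prim_root _ zn) ifN ?mulr0//.
  apply: contra jk => /dvdnP[d dE]; apply/eqP/val_inj => /=.
  have jn := ltn_ord j.
  have d1 : (d < 2)%N.
    rewrite -(ltn_pmul2r n0) -dE mul2n -addnn.
    by rewrite -addSn leq_add// leq_subr.
  case: d d1 dE => [|[|//]] _.
    by move/eqP; rewrite mul0n addn_eq0 subn_eq0 leqNgt kn andbF.
  rewrite mul1n => dE; apply/eqP.
  by rewrite -(eqn_add2r (n - k)) dE subnKC// ltnW.
rewrite -(ler_pM2l (_ : 0 < n%:R :> C)) ?ltr0n// -{1}(ger0_norm r0) -normrX -normrM.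
rewrite -{1}(normr_nat C n) -normrM -nE (le_trans (ler_norm_sum _ _ _))//.
apply: (le_trans (y := \sum_(i < n) B)); last by rewrite sumr_const card_ord mulr_natl.
apply: ler_sum => i _; rewrite normrM normrX (norm_prim_root zn) expr1n mulr1 qB//.
by rewrite normrM normrX (norm_prim_root zn) expr1n mulr1 ger0_norm.
Qed.

Lemma geometric_half_le n : \sum_(i < n) (2^-1 : C) ^+ i <= 2.
Proof.
suff -> : \sum_(i < n) (2^-1 : C) ^+ i = 2 - 2 * 2^-1 ^+ n.
  by rewrite gerBl mulr_ge0// exprn_ge0// invr_ge0.
elim: n => [|n IH]; first by rewrite big_ord0 expr0 mulr1 subrr.
rewrite big_ord_recr /= IH exprS mulrA mulfV ?pnatr_eq0// mul1r.
by rewrite mulr_natl mulr2n opprD addrA subrK.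
Qed.

(** The coefficient of degree [i + m] is at most B / r^(i+m), so on the half disc the tail is
    dominated by a geometric series of ratio 1/2. The case [m = 1] controls difference quotients,
    the case [m = 2] the error of the linear approximation. *)
Lemma drop_poly_disc_bound q B r m t : 0 < r ->
  (forall t, `|t| = r -> `|q.[t]| <= B) -> `|t| <= r / 2 ->
  `|(drop_poly m q).[t]| * r ^+ m <= 2 * B.
Proof.
move=> r0 qB tr.
have B0 : 0 <= B.
  by apply: le_trans (qB r _); rewrite ?normr_ge0// ger0_norm// ltW.
rewrite horner_coef.
apply: (le_trans (ler_wpM2r _ (ler_norm_sum _ _ _))); first exact/exprn_ge0/ltW.
rewrite mulr_suml; apply: le_trans (ler_wpM2r B0 (geometric_half_le (size (drop_poly m q)))).
rewrite mulr_suml; apply: ler_sum => i _; rewrite coef_drop_poly normrM normrX.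
have := coef_circle_bound (i + m) (ltW r0) qB.
rewrite exprD => H; rewrite [leRHS]mulrC.
apply: (le_trans (y := `|q`_(i + m)| * (r / 2) ^+ i * r ^+ m)).
  apply: ler_wpM2r; first exact/exprn_ge0/ltW.
  by apply: ler_wpM2l => //; apply: lerXn2r; rewrite ?nnegrE// divr_ge0// ltW.
rewrite exprMn.
rewrite (_ : _ * _ * _ = `|q`_(i + m)| * (r ^+ i * r ^+ m) * 2^-1 ^+ i); last by ring.
by rewrite ler_wpM2r// exprn_ge0// invr_ge0.
Qed.

(* By contraposition: if [q] has no root in the disc, compare [q] at the centre with
   the product of its values at the roots of [X^n - r^n] on the circle. *)
Lemma root_in_disc q c r K : 0 < r -> 0 < K ->
  (forall t, `|t| = r -> K <= `|q.[c + t]|) -> 2 * `|q.[c]| <= K ->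
  exists2 z, root q z & `|z - c| < r.
Proof.
move=> r0 K0 qK qc; have [s Ds] := closed_field_poly_normal q.
have [//|nroot] := pselect (exists2 z, root q z & `|z - c| < r); exfalso.
have q0 : q != 0.
  by apply: contraTneq (qK r (gtr0_norm r0)) => ->; rewrite horner0 normr0 lt_geF.
have sr w : w \in s -> r <= `|w - c|.
  move=> ws; rewrite (real_leNgt (gtr0_real r0) (normr_real _)); apply/negP => wr.
  apply: nroot; exists w => //; rewrite Ds rootZ ?lead_coef_eq0//.
  by rewrite root_prod_XsubC.
(* One more than the number of roots: each root will cost a factor 2, while [n] uses of the
   hypothesis on [q.[c]] gain [2 ^+ n]; the surplus factor makes the comparison strict. *)
pose n := (size s).+1.
have [u Du] := closed_field_poly_normal ('X^n - (r ^+ n)%:P : {poly C}).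
rewrite (monicP _) ?monicXnsubC // scale1r in Du.
have szu : size u = n.
  by apply: succn_inj; rewrite -(size_prod_XsubC u id) -Du size_XnsubC.
have ur z : z \in u -> `|z| = r.
  rewrite -root_prod_XsubC -Du rootE !hornerE subr_eq0 => /eqP zr.
  apply: (pexpIrn (ltn0Sn _ : (0 < n)%N)); rewrite ?nnegrE// ?(ltW r0)//.
  by rewrite -normrX zr normrX gtr0_norm.
have constE (a : C) (v : seq C) : \prod_(z <- v) a = a ^+ size v.
  by rewrite big_const_seq count_predT iter_mulr_1.
have qE x : q.[x] = lead_coef q * \prod_(w <- s) (x - w).
  rewrite {1}Ds hornerZ horner_prod; congr (_ * _).
  by apply: eq_bigr => v _; rewrite !hornerE.
have uE x : \prod_(z <- u) (x - z) = x ^+ n - r ^+ n.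
  have := congr1 (horner^~ x) Du; rewrite /= !hornerE horner_prod => ->.
  by apply: eq_bigr => v _; rewrite !hornerE.
have : K ^+ n <= \prod_(z <- u) `|q.[c + z]|.
  rewrite -szu -constE big_seq [leRHS]big_seq.
  by apply: ler_prod => z /ur zr; rewrite (ltW K0) qK.
have -> : \prod_(z <- u) `|q.[c + z]| =
    `|lead_coef q| ^+ n * \prod_(w <- s) `|(w - c) ^+ n - r ^+ n|.
  under eq_bigr => z _ do rewrite qE normrM normr_prod.
  rewrite big_split /= constE szu exchange_big /=; congr (_ * _).
  apply: eq_bigr => w' _; rewrite -uE normr_prod; apply: eq_bigr => z _.
  by rewrite distrC opprD addrA addrAC.
apply/negP; rewrite -real_ltNge ?rpredX ?(gtr0_real K0)//; last first.
  by rewrite rpredM ?rpredX ?rpred_prod// => *; rewrite ?normr_real.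
(* Every root satisfies r <= |w - c|, hence |(w - c)^n - r^n| <= 2 |w - c|^n. *)
apply: (@le_lt_trans _ _ (2 ^+ size s * `|q.[c]| ^+ n)).
  rewrite qE normrM exprMn mulrCA ler_wpM2l ?exprn_ge0//.
  rewrite normr_prod -prodrXl -(constE 2 s) -big_split /=.
  rewrite big_seq [leRHS]big_seq; apply: ler_prod => v vs; rewrite normr_ge0 /=.
  apply: le_trans (ler_normB _ _) _; rewrite !normrX (distrC c) mulr_natl mulr2n lerD2l.
  by apply: lerXn2r; rewrite ?nnegrE ?normr_ge0// gtr0_norm// sr.
rewrite -(ltr_pM2l (_ : 0 < 2)) // mulrA -exprS -exprMn.
apply: (@le_lt_trans _ _ (K ^+ n)).
  by apply: lerXn2r; rewrite ?nnegrE ?mulr_ge0 ?(ltW K0).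
by rewrite mulr_natl mulr2n ltrDl exprn_gt0.
Qed.

End PolynomialEstimates.

(** * Norms and compactness *)

Section MatrixNorm.
Variable K : numFieldType.

Lemma mx_entry_norm_le m n (A : 'M[K]_(m, n)) i j : `|A i j| <= `|A|.
Proof.
rewrite [`|A|]mx_normE -[leLHS]nngE num_le.
exact: (le_bigmax _ (fun ij : 'I_m * 'I_n => `|A ij.1 ij.2|%:nng) (i, j)).
Qed.

Lemma mx_norm_le_entries m n (A : 'M[K]_(m, n)) B : 0 <= B ->
  (forall i j, `|A i j| <= B) -> `|A| <= B.
Proof.
move=> B0 AB; rewrite [`|A|]mx_normE -[leRHS]/((NngNum B0)%:num) num_le.
by apply/bigmax_leP; split=> [|[i j] _]; rewrite -num_le //=.
Qed.

Lemma mulmx_norm_le m n k (A : 'M[K]_(m, n)) (B : 'M[K]_(n, k)) :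
  `|A *m B| <= n%:R * (`|A| * `|B|).
Proof.
apply: mx_norm_le_entries => [|i j]; first by rewrite !mulr_ge0.
rewrite mxE (le_trans (ler_norm_sum _ _ _))//.
apply: (@le_trans _ _ (\sum_(l < n) `|A| * `|B|)).
  by apply: ler_sum => l _; rewrite normrM ler_pM ?mx_entry_norm_le.
by rewrite sumr_const card_ord mulr_natl.
Qed.

Lemma closed_norm_le (V : normedModType K) (B : K) :
  closed [set x : V | `|x| <= B].
Proof.
move=> x clx; rewrite /=.
have [y [/= yB _]] := clx _ filterT.
(* The order is only partial; a point of the set shows that [B] is nonnegative, hence comparable
   with norms. *)
have Br : B \is Num.real by exact/ger0_real/le_trans/yB.
rewrite real_leNgt ?normr_real//; apply/negP => Bx.
have e0 : 0 < `|x| - B by rewrite subr_gt0.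
have [z [/= zB]] := clx _ (nbhsx_ballx x _ e0).
rewrite -ball_normE /= => xz.
have := le_lt_trans (lerB_dist x z) xz.
by rewrite ltrD2l ltrN2 => /(le_lt_trans zB); rewrite ltxx.
Qed.

End MatrixNorm.

(** An ultrafilter contains each neighbourhood of a cluster point or its complement, and the
    complement is excluded by clustering. *)
Lemma ultra_cvg_compact (I : Type) (T : topologicalType) (U : set_system I)
    (f : I -> T) (A : set T) : UltraFilter U -> compact A ->
  (\forall i \near U, A (f i)) -> exists2 x, A x & f @ U --> x.
Proof.
move=> UU cA UA; have PU := @ultra_proper _ _ UU.
have [x [Ax clx]] := cA (f @ U) _ UA.
exists x => // W xW; have [//|UnW] := in_ultra_setVsetC (f @^-1` W) UU.
by have [y [/= + Wy]] := clx (~` W) W UnW xW.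
Qed.

Section Compactness.
Variable R : realType.
Implicit Types B : Cplx R.

(** The disc is a closed subset of the continuous image of a real square. *)
Lemma cplx_disc_compact B : compact [set z : Cplx R | `|z| <= B].
Proof.
have [B0|/negP B0] := boolP (0 <= B); last first.
  have -> : [set z : Cplx R | `|z| <= B] = set0.
    by apply/seteqP; split => // z /= /(le_trans (normr_ge0 _)).
  exact: compact0.
pose b : R := complex.Re B.
have Bb : B = b%:C%C by rewrite /b RRe_real// ger0_real.
pose f (x : R * R) : Cplx R := (x.1 +i* x.2)%C.
have cf : continuous f.
  move=> x; apply/cvgrPdist_lt => e e0.
  pose d : R := complex.Re e.
  have ed : e = d%:C%C by rewrite /d RRe_real// gtr0_real.
  have d0 : 0 < d / 2 by rewrite divr_gt0// -ltcR -ed.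
  exists (ball x.1 (d / 2), ball x.2 (d / 2)) => /=.
    by split; apply: nbhsx_ballx.
  move=> [y1 y2] /= []; rewrite -!ball_normE /= => h1 h2.
  have -> : f x - f (y1, y2) = (x.1 - y1)%:C%C + 'i%C * (x.2 - y2)%:C%C.
    by apply/eqP; rewrite eq_complex /=; apply/andP; split; apply/eqP; ring.
  apply: (le_lt_trans (ler_normD _ _)).
  have Cn (z : R) : `|z%:C%C| = `|z|%:C%C :> Cplx R.
    by rewrite normc_def /= expr0n /= addr0 sqrtr_sqr.
  have i1 : `|'i%C| = 1 :> Cplx R.
    by rewrite normc_def /= expr0n /= add0r expr1n sqrtr1.
  rewrite normrM i1 mul1r !Cn ed -raddfD /= ltcR.
  by rewrite [ltRHS]splitr ltrD.
have cI : compact [set f x | x in `[- b, b] `*` `[- b, b]].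
  apply: continuous_compact; first exact: continuous_subspaceT.
  by apply: compact_setX; apply: segment_compact.
apply: (subclosed_compact _ cI); first exact: (closed_norm_le (V := Cplx R)).
move=> z /= zB; exists (complex.Re z, complex.Im z); last by case: z zB.
have hr : `|complex.Re z| <= b.
  by rewrite -lecR -Bb (le_trans _ zB)// normc_ge_Re.
have hi : `|complex.Im z| <= b.
  rewrite -lecR -Bb (le_trans _ zB)// normc_def lecR -sqrtr_sqr.
  by rewrite ler_wsqrtr// lerDr sqr_ge0.
by split; rewrite /= in_itv /= -ler_norml.
Qed.

Lemma cplx_archimedean (A : Cplx R) : A \is Num.real -> exists n, A < n%:R.
Proof.
move=> Ar; pose a : R := complex.Re A.
have Aa : A = a%:C%C by rewrite /a RRe_real.
exists (Num.bound `|a|); rewrite Aa -(rmorph_nat (real_complex R)) ltcR.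
exact: le_lt_trans (ler_norm _) (archi_boundP (normr_ge0 _)).
Qed.

(* Keeps [/=] from reducing [Cplx R] to [R[i]], which has no topology. *)
Opaque Cplx.
Arguments Cplx : simpl never.

(** Along an ultrafilter each entry converges in a compact disc; as there are finitely many entries,
    the matrix converges in norm. *)
Lemma mx_norm_ball_compact m n B : compact [set A : 'M[Cplx R]_(m, n) | `|A| <= B].
Proof.
rewrite compact_ultra => F UF FB; have PF := @ultra_proper _ _ UF.
have cvgij i j : exists z : Cplx R, (fun A : 'M[Cplx R]_(m, n) => A i j) @ F --> z.
  have [|z _ Fz] := ultra_cvg_compact (f := fun A : 'M[Cplx R]_(m, n) => A i j) UF
    (@cplx_disc_compact B); last by exists z.
  by apply: filterS FB => A /= AB; exact/le_trans/AB/mx_entry_norm_le.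
have [z /= zP] := choice (fun ij : 'I_m * 'I_n => cvgij ij.1 ij.2).
pose Z : 'M[Cplx R]_(m, n) := \matrix_(i, j) z (i, j).
have FZ : F --> Z.
  apply/fcvgrPdist_lt => e e0.
  have e20 : 0 < e / 2 by rewrite divr_gt0.
  have : \forall A \near F, forall ij : 'I_m * 'I_n,
      `|z ij - (A : 'M[Cplx R]_(m, n)) ij.1 ij.2| < e / 2.
    apply: (@filter_forall _ _ (fun ij =>
      [set A : 'M[Cplx R]_(m, n) | `|z ij - A ij.1 ij.2| < e / 2])) => ij.
    by have /cvgrPdist_lt H := zP ij; exact: H.
  apply: filterS => A Ae; apply: (@le_lt_trans _ _ (e / 2)).
    apply: mx_norm_le_entries => [|i j]; first exact: ltW.
    by rewrite !mxE; exact/ltW/(Ae (i, j)).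
  by rewrite [ltRHS]splitr ltrDl.
exists Z; split => //.
exact: (@closed_cvg _ _ F _ id _ (closed_norm_le (B := B)) FB Z FZ).
Qed.

End Compactness.

(** * Montel's theorem *)

Lemma differentiable_quadratic (K : numFieldType) (V W : normedModType K)
    (f : V -> W) (l : {linear V -> W}) x r M : continuous l -> 0 < r -> 0 < M ->
  (forall h, `|h| <= r -> `|f (x + h) - f x - l h| <= M * `|h| ^+ 2) ->
  differentiable f x.
Proof.
move=> lc r0 M0 H; apply/diffP.
(* The differential is defined by [get], so exhibiting one continuous linear map with the required
   expansion is enough. *)
apply: (@getPex _ (fun (df : {linear V -> W}) => continuous df /\
  forall y, f y = f (lim (nbhs x)) + df (y - lim (nbhs x))
                  +o_(y \near x) (y - lim (nbhs x)))).
exists l; split=> //.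
have : f = (fun y => f (lim (nbhs x)) + l (y - lim (nbhs x)))
    +o_ (nbhs x) (fun y => y - lim (nbhs x)).
  apply/eqaddoP => e e0; rewrite lim_id//.
  have nx d : 0 < d -> \forall y \near x, `|y - x| < d.
    by move=> d0; apply: filterS (nbhsx_ballx x _ d0) => y; rewrite -ball_normE /= distrC.
  have near1 := nx _ r0; have near2 := nx _ (divr_gt0 e0 M0).
  apply: filterS2 near1 near2 => y /ltW yr /ltW ye.
  have := H (y - x) yr; rewrite [x + _]addrC subrK -addrA -opprD => /le_trans; apply.
  by rewrite expr2 mulrA ler_wpM2r// mulrC -ler_pdivlMr.
by rewrite funeqE.
Qed.

Section NormalFamilies.
Variables (R : realType) (m n : nat).
Local Notation C := (Cplx R).
Local Notation V := 'M[C]_(m, n).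
Implicit Types (f g : V -> V) (x h : V) (B r : C).

(* An algebraic stand-in for holomorphy: the restrictions to complex lines are subject to
   Cauchy's estimates, and [l] is the differential. *)
Definition line_poly f := forall x, exists l : {linear V -> V}, forall h i j,
  exists q : {poly C}, [/\ q`_0 = f x i j, q`_1 = l h i j &
    forall t, f (x + t *: h) i j = q.[t]].

(** In the parameter [t] of the line [x + t *: h], the ball of radius [r] becomes the disc of radius
    [s], the quotient of [r] by the norm of [h]. The three bounds are Cauchy's estimates there at
    [t = 1]: for the coefficient of degree 1 and for the tails from degrees 1 and 2. The condition
    on [h] says that 1 lies in the half disc. *)
Lemma line_poly_taylor f x (l : {linear V -> V}) B r : 0 < r ->
  (forall h i j, exists q : {poly C}, [/\ q`_0 = f x i j, q`_1 = l h i j &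
    forall t, f (x + t *: h) i j = q.[t]]) ->
  (forall y, `|y - x| <= r -> `|f y| <= B) ->
  forall h, [/\ `|l h| * r <= B * `|h|,
    `|h| <= r / 2 -> `|f (x + h) - f x| * r <= 2 * B * `|h| &
    `|h| <= r / 2 -> `|f (x + h) - f x - l h| * r ^+ 2 <= 2 * B * `|h| ^+ 2].
Proof.
move=> r0 fl fB h.
have B0 : 0 <= B by apply: le_trans (fB x _); rewrite ?subrr ?normr0 ?(ltW r0).
have [->|h0] := eqVneq h 0.
  by split; rewrite ?linear0 ?addr0 ?subrr ?subr0 ?subrr ?normr0 ?mul0r ?mulr0 ?expr0n ?mulr0.
have nh0 : 0 < `|h| by rewrite normr_gt0.
pose s := r / `|h|; have s0 : 0 < s by rewrite divr_gt0.
have rE : r = s * `|h| by rewrite divfK// gt_eqF.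
have entry (A : V) c D : 0 < c -> 0 <= D ->
    (forall i j, `|A i j| * c <= D) -> `|A| * c <= D.
  move=> c0 D0 AD; rewrite -ler_pdivlMr//; apply: mx_norm_le_entries.
    by rewrite divr_ge0// ltW.
  by move=> i j; rewrite ler_pdivlMr.
have qb i j (q : {poly C}) : (forall t, f (x + t *: h) i j = q.[t]) ->
    forall t, `|t| = s -> `|q.[t]| <= B.
  move=> qE t ts; rewrite -qE; apply: le_trans (mx_entry_norm_le _ _ _) _.
  by apply: fB; rewrite addrC addKr normrZ ts rE.
have s1 : `|h| <= r / 2 -> `|1 : C| <= s / 2.
  by rewrite normr1 rE mulrAC -{1}[`|h|]mul1r ler_pM2r.
have f1 : f (x + h) = f (x + 1 *: h) by rewrite scale1r.
split.
- rewrite rE mulrA ler_pM2r//; apply: entry => // i j.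
  have [q [_ <- qE]] := fl h i j.
  by have := coef_circle_bound 1 (ltW s0) (qb _ _ _ qE); rewrite expr1.
- move=> hr; rewrite rE mulrA ler_pM2r// f1; apply: entry => [//||i j].
    by rewrite mulr_ge0.
  have [q [q0 _ qE]] := fl h i j.
  have := drop_poly_disc_bound 1 s0 (qb _ _ _ qE) (s1 hr).
  rewrite expr1 !mxE qE -q0 -{2}(poly_take_drop 1 q) hornerD hornerM hornerXn expr1n mulr1.
  rewrite (_ : (take_poly 1 q).[1] = q`_0) ?[q`_0 + _]addrC ?addrK//.
  by rewrite /take_poly poly_def big_ord_recl big_ord0 addr0 expr0 hornerZ hornerE mulr1.
- move=> hr; rewrite rE exprMn mulrA ler_pM2r ?exprn_gt0// f1; apply: entry => [||i j].
  + by rewrite exprn_gt0.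
  + by rewrite mulr_ge0.
  have [q [q0 q1 qE]] := fl h i j.
  have := drop_poly_disc_bound 2 s0 (qb _ _ _ qE) (s1 hr).
  have qD : q.[1] = q`_0 + q`_1 + (drop_poly 2 q).[1].
    rewrite -{1}(poly_take_drop 2 q) hornerD hornerM hornerXn expr1n mulr1.
    congr (_ + _); rewrite /take_poly poly_def !big_ord_recl big_ord0 addr0 hornerD.
    by rewrite !hornerZ !hornerXn !expr1n !mulr1.
  rewrite !mxE qE -q0 -q1 qD; set d := (drop_poly 2 q).[1].
  by rewrite (_ : _ - _ = d)//; ring.
Qed.

Lemma linear_of_fun (l : V -> V) : linear l -> exists l' : {linear V -> V}, l' =1 l.
Proof.
move=> lin; pose l' : {linear V -> V} := HB.pack l (GRing.isLinear.Build _ _ _ _ l lin).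
by exists l'.
Qed.

Section Montel.
Variables (f : nat -> V -> V) (x0 : V) (r B : C).
Hypotheses (r0 : 0 < r) (B0 : 0 < B).
Hypothesis f_line : forall k, line_poly (f k).
Hypothesis fB : forall k y, `|y - x0| <= r * 2 -> `|f k y| <= B.

(** The doubled radius in [fB] lets the estimates of radius [r] be centred anywhere in the ball of
    radius [r]. *)
Let fB_near x y : `|x - x0| <= r -> `|y - x| <= r -> forall k, `|f k y| <= B.
Proof.
move=> xr yr k; apply: fB; rewrite -(subrK x y) -addrA.
by rewrite (le_trans (ler_normD _ _))// mulr_natr mulr2n lerD.
Qed.

(* The candidate limit is the limit along a free ultrafilter, which exists pointwise by
   compactness; equicontinuity makes the convergence uniform. *)
Lemma montel_ultra : exists (U : set_system nat) (g : V -> V),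
  [/\ UltraFilter U, \oo `<=` U,
    holomorphic_on [set x | `|x - x0| < r] g &
    forall e, 0 < e -> \forall k \near U, forall y, `|y - x0| <= r / 4 -> `|f k y - g y| <= e].
Proof.
have [U [UU ooU]] := ultraFilterLemma eventually_filter.
have PU := @ultra_proper _ _ UU.
have gex : forall y, exists z : V, `|y - x0| <= r * 2 -> (fun k => f k y) @ U --> z.
  move=> y.
  have [yr|] := pselect (`|y - x0| <= r * 2); last by exists 0.
  have [|z _ zP] := ultra_cvg_compact (f := fun k => f k y) UU (@mx_norm_ball_compact R m n B).
    by apply: filterE => k; exact: fB.
  by exists z.
have [g gP] := choice gex; clear gex.
have lex : forall kx : nat * V, exists l : {linear V -> V},
    forall h i j, exists q : {poly C}, [/\ q`_0 = f kx.1 kx.2 i j, q`_1 = l h i j &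
      forall t, f kx.1 (kx.2 + t *: h) i j = q.[t]].
  by move=> [k x]; have [l lP] := f_line k x; exists l.
have [l lP] := choice lex; clear lex.
have taylor k x h : `|x - x0| <= r ->  [/\ `|l (k, x) h| * r <= B * `|h|,
    `|h| <= r / 2 -> `|f k (x + h) - f k x| * r <= 2 * B * `|h| &
    `|h| <= r / 2 -> `|f k (x + h) - f k x - l (k, x) h| * r ^+ 2 <= 2 * B * `|h| ^+ 2].
  move=> xr; apply: line_poly_taylor => // [h' i j|y yr]; first exact: (lP (k, x)).
  exact: fB_near xr yr k.
have r2 : r <= r * 2 by rewrite ler_peMr ?ler1n// ltW.
have half_lt : r / 2 <= r by rewrite ler_pdivrMr// r2.
have gP' x h : `|x - x0| <= r -> `|h| <= r / 2 -> (fun k => f k (x + h)) @ U --> g (x + h).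
  move=> xr hr; apply: gP; rewrite addrAC (le_trans (ler_normD _ _))//.
  by rewrite mulr_natr mulr2n lerD// (le_trans hr).
have glip x h : `|x - x0| <= r -> `|h| <= r / 2 -> `|g (x + h) - g x| <= 2 * B * `|h| / r.
  move=> xr hr.
  have cv : (fun k => f k (x + h) - f k x) @ U --> g (x + h) - g x.
    by apply: cvgB; [exact: gP'|apply: gP; exact: le_trans r2].
  apply: (@closed_cvg _ _ U _ _ _ (closed_norm_le (B := 2 * B * `|h| / r)) _ _ cv).
  apply: filterE => k /=; rewrite ler_pdivlMr//.
  by have [_ H _] := taylor k x h xr; exact: H.
exists U, g; split => //.
- move=> x /= /ltW xr.
  (* The differential of [g] is the limit along [U] of the differentials of the [f k]; its
     linearity, its bound and the quadratic remainder estimate pass to the limit. *)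
  have Lex : forall h, exists z : V, (fun k => l (k, x) h) @ U --> z.
    move=> h.
    have [|z _ zP] := ultra_cvg_compact (f := fun k => l (k, x) h) UU
        (@mx_norm_ball_compact R m n (B * `|h| / r)); last by exists z.
    by apply: filterE => k /=; rewrite ler_pdivlMr//; have [] := taylor k x h xr.
  have [L LP] := choice Lex; clear Lex.
  have Llin : linear L.
    move=> a u v; apply: (@cvg_unique _ (@norm_hausdorff _ _) _ _ _ _ (LP (a *: u + v))).
    have -> : (fun k => l (k, x) (a *: u + v)) = (fun k => a *: l (k, x) u + l (k, x) v).
      by apply/funext => k; rewrite linearP.
    by apply: cvgD; [apply: cvgZl_tmp; exact: LP|exact: LP].
  have [L' L'E] := linear_of_fun Llin.
  have Lb h : `|L' h| <= B * `|h| / r.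
    rewrite L'E; apply: (@closed_cvg _ _ U _ _ _ (closed_norm_le (B := B * `|h| / r)) _ _ (LP h)).
    by apply: filterE => k /=; rewrite ler_pdivlMr//; have [] := taylor k x h xr.
  have M0 : 0 < 2 * B / r ^+ 2 by rewrite divr_gt0 ?mulr_gt0// exprn_gt0.
  have Lc : continuous L'.
    apply: bounded_linear_continuous; exists (B / r).
    split=> [|M BM]; first by rewrite gtr0_real// divr_gt0.
    apply: filterS (nbhsx_ballx (0 : V) _ ltr01) => h; rewrite -ball_normE /= sub0r normrN => h1.
    by rewrite (le_trans (Lb h))// (le_trans _ (ltW BM))// ler_pM2r ?invr_gt0// ler_piMr// ltW.
  have r20 : 0 < r / 2 by rewrite divr_gt0.
  apply: (differentiable_quadratic Lc r20 M0).
  move=> h hr; rewrite L'E mulrAC.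
  have cv : (fun k => f k (x + h) - f k x - l (k, x) h) @ U --> g (x + h) - g x - L h.
    by apply: cvgB => //; apply: cvgB; [exact: gP'|apply: gP; exact: le_trans r2].
  apply: (@closed_cvg _ _ U _ _ _ (closed_norm_le (B := 2 * B * `|h| ^+ 2 / r ^+ 2)) _ _ cv).
  apply: filterE => k /=; rewrite ler_pdivlMr// ?exprn_gt0//.
  by have [_ _ H] := taylor k x h xr; exact: H.
- move=> e e0.
  have /compact_near_coveringP/near_covering_withinP cK := @mx_norm_ball_compact R m n (r / 4).
  have r4 : r / 4 <= r / 2.
    by rewrite ler_pM2l// lef_pV2 ?posrE// ler_nat.
  have r4r : r / 4 <= r by rewrite (le_trans r4).
  have near_h := cK nat U (fun k h => `|f k (x0 + h) - g (x0 + h)| <= e) _.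
  suff : \forall k \near U, [set h : V | `|h| <= r / 4] `<=`
      (fun h => `|f k (x0 + h) - g (x0 + h)| <= e).
    by apply: filterS => k H y yr; have := H _ yr; rewrite /= [x0 + _]addrC subrK.
  (* A three-term estimate with [e / 3] each. Points of the ball of radius [r / 4] are at most
     [r / 2] apart, which is the range of the Lipschitz bound, and [d] is chosen so that the
     Lipschitz constant times [d] is [e / 3]. *)
  apply: near_h => h /= hr.
  have e3 : 0 < e / 3 by rewrite divr_gt0.
  pose d := e / 3 / (2 * B / r).
  have d0 : 0 < d by rewrite !divr_gt0// mulr_gt0.
  have h0r : `|x0 + h - x0| <= r by rewrite addrAC subrr add0r (le_trans hr).
  have fg : \forall k \near U, `|f k (x0 + h) - g (x0 + h)| <= e / 3.
    have /cvgrPdistC_le H := gP _ (le_trans h0r r2); exact: H.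
  have hd : \forall h' \near h, `|h' - h| <= d.
    by apply: filterS (nbhsx_ballx h _ d0) => y; rewrite -ball_normE /= distrC => /ltW.
  exists ([set h' | `|h' - h| <= d], [set k | `|f k (x0 + h) - g (x0 + h)| <= e / 3]) => //.
  move=> [h' k] /= [hd' fgk] hr'.
  have hh : `|h' - h| <= r / 2.
    rewrite (le_trans (ler_normB _ _))// (le_trans (lerD hr' hr))//.
    by rewrite (_ : _ + _ = r / 2)//; field.
  have hE : x0 + h' = x0 + h + (h' - h) by rewrite -addrA [h + _]addrC subrK.
  have dB : 2 * B * `|h' - h| / r <= e / 3.
    by rewrite mulrAC mulrC -ler_pdivlMr// divr_gt0// mulr_gt0.
  have fl : `|f k (x0 + h') - f k (x0 + h)| <= e / 3.
    have [_ /(_ hh) + _] := taylor k (x0 + h) (h' - h) h0r.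
    by rewrite hE -ler_pdivlMr// => /le_trans; apply.
  have gl : `|g (x0 + h') - g (x0 + h)| <= e / 3.
    by rewrite hE (le_trans (glip _ _ h0r hh)).
  have -> : f k (x0 + h') - g (x0 + h') = (f k (x0 + h') - f k (x0 + h))
     + (f k (x0 + h) - g (x0 + h)) + (g (x0 + h) - g (x0 + h')).
    by rewrite !addrA !subrK.
  rewrite (le_trans (ler_normD _ _))// (_ : e = e / 3 + e / 3 + e / 3); last by field.
  by apply: lerD; [apply: le_trans (ler_normD _ _) _; exact: lerD|rewrite distrC].
Qed.

Lemma montel : exists s : nat -> nat, {homo s : m n / (m < n)%N} /\
  exists g, holomorphic_on [set x | `|x - x0| < r / 4] g /\
    cvg_unif_on_compacts [set x | `|x - x0| < r / 4] (f \o s) g.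
Proof.
have [U [g [UU ooU g_hol fg]]] := montel_ultra.
have PU := @ultra_proper _ _ UU.
(* [U] contains every tail of the integers, so each of its members contains arbitrarily large
   indices; this turns convergence along [U] into a subsequence. *)
have next (Nk : nat * nat) : exists k, (Nk.1 < k)%N /\
    forall y, `|y - x0| <= r / 4 -> `|f k y - g y| <= Nk.2.+1%:R^-1.
  have H1 : U [set k | (Nk.1 < k)%N] by apply: ooU; exact: nbhs_infty_gt.
  have i0 : 0 < Nk.2.+1%:R^-1 :> C by rewrite invr_gt0 ltr0n.
  by have [k [k1 k2]] := filter_ex (filterI H1 (fg _ i0)); exists k.
have [F FP] := choice next.
pose s := fix s k := if k is k'.+1 then F (s k', k) else F (0, 0)%N.
have sP k y : `|y - x0| <= r / 4 -> `|f (s k) y - g y| <= k.+1%:R^-1.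
  by case: k => [|k]; [exact: (FP (0, 0)%N).2|exact: (FP (s k, k.+1)).2].
exists s; split; first by apply: homo_ltn ltn_trans _ => k; exact: (FP (s k, k.+1)).1.
exists g; split.
  move=> x /= xr; apply: g_hol => /=; rewrite (lt_trans xr)// ltr_pdivrMr//.
  by rewrite ltr_pMr// ltr1n.
move=> K _ Ksub P /uniform_nbhs [E [entE EP]].
have [e /= e0 eE] : entourage_ ball E by rewrite entourage_ballE.
have ei0 : 0 < e^-1 by rewrite invr_gt0.
have [N eN] := cplx_archimedean (gtr0_real ei0).
exists N => // k /= Nk; apply: EP => y Ky; apply: eE.
rewrite /= -ball_normE /= distrC; apply: (le_lt_trans (sP k y _)).
  exact/ltW/Ksub.
rewrite -[e]invrK ltf_pV2 ?posrE ?ltr0n//.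
by apply: (lt_le_trans eN); rewrite ler_nat (leq_trans Nk).
Qed.

End Montel.

End NormalFamilies.

(** * The filled Julia set of a polynomial *)

Lemma escape_radius (K : numFieldType) (p : {poly K}) : (2 < size p)%N ->
  exists2 rho : K, 1 <= rho & forall z, rho < `|z| -> 2 * `|z| <= `|p.[z]|.
Proof.
move=> hp; pose d := (size p).-1; pose a := lead_coef p.
have dE : size p = d.+1 by rewrite prednK// (ltn_trans _ hp).
have d1 : (1 < d)%N by rewrite /d -ltnS prednK// (ltn_trans _ hp).
have a0 : 0 < `|a| by rewrite normr_gt0 lead_coef_eq0 -size_poly_gt0 (ltn_trans _ hp).
pose S := \sum_(i < d) `|p`_i|; have S0 : 0 <= S by apply: sumr_ge0.
have S2 : 0 <= (S + 2) / `|a| by rewrite divr_ge0 ?addr_ge0// ltW.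
(* Outside this radius, |a||z| >= S + 2 and |z| >= 1 give |p(z)| >= (|a||z| - S) |z|^(d-1) >= 2|z|,
   as d >= 2. *)
exists (1 + (S + 2) / `|a|) => [|z zr]; first by rewrite lerDl.
have z1 : 1 <= `|z| by rewrite (le_trans _ (ltW zr))// lerDl.
have z0 : 0 < `|z| by exact: lt_le_trans z1.
have az : S + 2 <= `|a| * `|z|.
  by rewrite mulrC -ler_pdivrMr// (le_trans _ (ltW zr))// lerDr.
have -> : p.[z] = a * z ^+ d - - \sum_(i < d) p`_i * z ^+ i.
  rewrite opprK horner_coef dE.
  by rewrite big_ord_recr /= addrC.
rewrite (le_trans _ (lerB_dist _ _))// normrN normrM normrX.
have sumS : `|\sum_(i < d) p`_i * z ^+ i| <= S * `|z| ^+ d.-1.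
  rewrite (le_trans (ler_norm_sum _ _ _))// mulr_suml; apply: ler_sum => i _.
  rewrite normrM normrX ler_wpM2l// ler_weXn2l//.
  by rewrite -ltnS prednK// (ltn_trans _ d1).
rewrite (le_trans _ (lerB (lexx _) sumS))//.
rewrite -{1}(prednK (ltnW d1)) exprS mulrA -mulrBl.
rewrite ler_pM// ?lerBrDl//.
by rewrite -{1}[`|z|]expr1 ler_weXn2l// -ltnS prednK// ltnW.
Qed.

(** One polynomial whose evaluation at a number or at a matrix gives both iterations, so that
    coefficient estimates apply to the iterates. *)
Definition iter_poly (K : comNzRingType) (p : {poly K}) n : {poly K} :=
  iter n (fun q => p \Po q) 'X.

Lemma horner_iter_poly (K : comNzRingType) (p : {poly K}) n z :
  (iter_poly p n).[z] = iter n (horner p) z.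
Proof. by elim: n => [|n IH] /=; rewrite ?hornerX// horner_comp IH. Qed.

Lemma horner_mx_comp (K : comNzRingType) n (M : 'M[K]_n.+1) (p q : {poly K}) :
  horner_mx M (p \Po q) = horner_mx (horner_mx M q) p.
Proof.
elim/poly_ind: p => [|p c IH]; first by rewrite comp_poly0 !rmorph0.
by rewrite comp_poly_MXaddC !rmorphD !rmorphM /= IH horner_mx_X !horner_mx_C.
Qed.

Lemma horner_continuous (K : numFieldType) (p : {poly K}) : continuous (horner p).
Proof.
move=> z; elim/poly_ind: p => [|p c IH].
  have -> : horner (0 : {poly K}) = cst 0 by apply/funext => x; rewrite horner0.
  exact: cst_continuous.
have -> : horner (p * 'X + c%:P) = (fun x => p.[x] * x + c).
  by apply/funext => x; rewrite hornerMXaddC.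
apply: (@cvgD K K K (nbhs z) _ (fun x => p.[x] * x) (cst c)); last exact: cvg_cst.
by apply: (@cvgM K K (nbhs z) _ (horner p) id).
Qed.

Section FilledJulia.
Variables (R : realType) (p : {poly Cplx R}).
Local Notation C := (Cplx R).
Local Notation "p ^[ n ]" := (iter n (horner p)) (at level 2, format "p ^[ n ]").
Variable rho : C.
Hypotheses (rho1 : 1 <= rho) (rhoP : forall z, rho < `|z| -> 2 * `|z| <= `|p.[z]|).
Implicit Types (z w : C).

Let rho0 : 0 < rho. Proof. exact: lt_le_trans rho1. Qed.

Lemma escape_growth z k : rho < `|z| -> 2 ^+ k * `|z| <= `|p^[k] z|.
Proof.
move=> zr; elim: k => [|k IH] /=; first by rewrite mul1r.
rewrite exprS -mulrA (le_trans _ (rhoP _))//; first by rewrite ler_pM2l.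
apply: (lt_le_trans zr); apply: le_trans IH.
by rewrite ler_peMl// exprn_ege1// ler1n.
Qed.

(* The rank beyond which the orbit leaves the disc of radius [A] depends on the point
   only through the time [N] at which it leaves the disc of radius [rho]. *)
Lemma escape_uniform N (A : C) : A \is Num.real ->
  \forall n \near \oo, forall z, rho < `|p^[N] z| -> A < `|p^[n] z|.
Proof.
move=> Ar; have [k Ak] := cplx_archimedean Ar.
exists (N + k)%N => // n /= Nkn z zr.
have -> : n = (n - N + N)%N by rewrite subnK// (leq_trans _ Nkn)// leq_addr.
rewrite iterD; apply: (lt_le_trans Ak); apply: le_trans (escape_growth _ zr).
apply: (@le_trans _ _ (2 ^+ (n - N) * 1)); last first.
  by rewrite ler_pM2l ?exprn_gt0// (le_trans rho1)// ltW.
rewrite mulr1 -natrX ler_nat (leq_trans _ (ltnW (ltn_expl _ _)))//.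
by rewrite leq_subRL// (leq_trans _ Nkn)// leq_addr.
Qed.

(** An orbit outside the disc of radius [rho] at least doubles at each step, so a bounded orbit
    never leaves it. Time 0 is included, although the definition of the filled Julia set starts at
    time 1. *)
Lemma filled_juliaP z : filled_julia p z <-> forall n, `|p^[n] z| <= rho.
Proof.
split=> [zb n|zb].
  rewrite (real_leNgt (normr_real _) (gtr0_real rho0)); apply/negP => zr.
  have [M [Mr MP]] := zb.
  have M1r : M + 1 \is Num.real by rewrite rpredD ?rpred1.
  have [N _ NP] := escape_uniform n M1r.
  have := MP (M + 1) _ (p^[N.+1] z); rewrite ltrDl ltr01 => /(_ isT) /= H.
  have : `|p^[N.+1] z| <= M + 1 by apply: H; exists N.+1.
  by apply/negP; rewrite -(real_ltNge M1r (normr_real _)); exact: NP (leqnSn N) _ zr.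
exists rho; split=> [|M rM _ [n _ <-]] /=; first exact: gtr0_real.
exact: le_trans (ltW rM).
Qed.

Lemma bounded_filled_julia z M : (forall n, `|p^[n] z| <= M) -> filled_julia p z.
Proof.
move=> zM; exists M; split=> [|A MA _ [n _ <-]] /=.
  exact/ger0_real/le_trans/(zM 0%N).
exact: le_trans (ltW MA).
Qed.

Lemma filled_julia_iter n z : filled_julia p (p^[n] z) -> filled_julia p z.
Proof.
move=> /filled_juliaP zb; apply/filled_juliaP => k.
rewrite (real_leNgt (normr_real _) (gtr0_real rho0)); apply/negP => zr.
have : rho < `|p^[n + k] z|.
  rewrite iterD; apply: (lt_le_trans zr); apply: le_trans (escape_growth n zr).
  by rewrite ler_peMl// exprn_ege1// ler1n.
by rewrite addnC iterD => /lt_le_trans/(_ (zb k)); rewrite ltxx.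
Qed.

Lemma filled_julia_horner z : filled_julia p z -> filled_julia p p.[z].
Proof.
by move=> /filled_juliaP zb; apply/filled_juliaP => n; rewrite -iterSr.
Qed.

Lemma escape_near z : ~ filled_julia p z ->
  exists N, \forall w \near z, rho < `|p^[N] w|.
Proof.
move=> /filled_juliaP/existsNP[N]/negP; rewrite -(real_ltNge (gtr0_real rho0) (normr_real _)) => zN.
exists N; have d0 : 0 < `|p^[N] z| - rho by rewrite subr_gt0.
have cN : (horner (iter_poly p N)) @ z --> (iter_poly p N).[z] by exact: horner_continuous.
have /cvgrPdist_lt/(_ _ d0) := cN.
apply: filterS => w; rewrite !horner_iter_poly => /(le_lt_trans (lerB_dist _ _)).
by rewrite ltrD2l ltrN2.
Qed.

Lemma closed_filled_julia : closed (filled_julia p).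
Proof.
move=> z clz; apply: contrapT => /escape_near[N Nz].
have [w [/filled_juliaP wK wN]] := clz _ Nz.
by have := lt_le_trans wN (wK N); rewrite ltxx.
Qed.

Lemma juliaE z : julia p z <-> filled_julia p z /\ ~ (filled_julia p)^° z.
Proof. by rewrite /julia /boundary -(closure_id _).1//; exact: closed_filled_julia. Qed.

(* An isolated point of [K_p] would be, for some [n], the only preimage under [p^n] in a
   small disc of every point of [K_p]; then [K_p] is a point, which is a superattracting
   fixed point. *)
Lemma filled_julia_perfect z e : (2 < size p)%N -> filled_julia p z -> 0 < e ->
  exists w, [/\ filled_julia p w, w != z & `|w - z| < e].
Proof.
move=> hp zK e0; apply: contrapT => iso.
have {}iso w : filled_julia p w -> `|w - z| < e -> w = z.
  move=> wK wz; apply/eqP; apply: contrapT => /negP wnz; apply: iso.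
  by exists w; split.
pose r := e / 2; have r0 : 0 < r by rewrite divr_gt0.
have re : r < e by rewrite ltr_pdivrMr// ltr_pMr// ltr1n.
have r5 : rho * 5 \is Num.real by rewrite gtr0_real// mulr_gt0.
have [n nP] : exists n, forall t, `|t| = r -> rho * 5 < `|p^[n] (z + t)|.
  (* Every point of the circle escapes, and compactness yields a common time. It is applied to the
     whole disc, the condition being vacuous near the centre [t = 0]. *)
  have /compact_near_coveringP/near_covering_withinP cK := @cplx_disc_compact R r.
  suff : \forall n \near \oo, [set t : C | `|t| <= r] `<=`
      (fun t => `|t| = r -> rho * 5 < `|p^[n] (z + t)|).
    by move=> /filter_ex[n nP]; exists n => t tr; apply: nP => //=; rewrite tr.
  apply: cK => t /= tr.
  have [->|t0] := eqVneq t 0.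
    exists ([set t | `|t| < r], setT).
      split; last exact: filterT.
      by apply: filterS (nbhsx_ballx (0 : C) _ r0) => w; rewrite -ball_normE /= sub0r normrN.
    by move=> [t' k] [/= t'r _] _ t'E; move: t'r; rewrite t'E ltxx.
  have zt : ~ filled_julia p (z + t).
    move=> /iso H; move: t0; have := H; rewrite addrAC subrr add0r => /(_ (le_lt_trans tr re))/eqP.
    by rewrite -subr_eq0 addrAC subrr add0r => ->.
  have [N NP] := escape_near zt.
  have NPt : \forall t' \near t, rho < `|p^[N] (z + t')|.
    have cT : (fun t' : C => z + t') @ t --> z + t.
      by apply: (@cvgD C C C (nbhs t) _ (cst z) id); [exact: cvg_cst|exact: cvg_id].
    exact: cT NP.
  have := escape_uniform N r5 => Hu.
  exists ([set t' | rho < `|p^[N] (z + t')|],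
    [set k | forall w, rho < `|p^[N] w| -> rho * 5 < `|p^[k] w|]) => //.
  by move=> [t' k] [/= H1 H2] _ _; exact: H2.
(* On the circle |p^n - w| is at least [rho * 5 - rho], at the centre at most [rho * 2]: hence the
   constant [rho * 4] for [root_in_disc]. The root lies in [K_p], so it is [z]. *)
have zw w : filled_julia p w -> w = p^[n] z.
  move=> wK; have wr := (filled_juliaP w).1 wK 0%N.
  have r4 : 0 < rho * 4 by rewrite mulr_gt0.
  have [t tr||u] := @root_in_disc C (iter_poly p n - w%:P) z r (rho * 4) r0 r4.
  - rewrite !hornerE horner_iter_poly (le_trans _ (lerB_dist _ _))//.
    rewrite lerBrDr (le_trans _ (ltW (nP _ tr)))//.
    by rewrite (_ : rho * 5 = rho * 4 + rho) ?lerD2l//; ring.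
  - rewrite !hornerE horner_iter_poly.
    rewrite (_ : rho * 4 = 2 * (rho + rho)); last by ring.
    rewrite ler_pM2l// (le_trans (ler_normB _ _))// lerD//.
    exact: (filled_juliaP z).1.
  - rewrite rootE !hornerE horner_iter_poly subr_eq0 => /eqP uw uz.
    have uK : filled_julia p u by apply: (@filled_julia_iter n); rewrite uw.
    by rewrite -(iso _ uK (lt_trans uz re)) uw.
have Ksing w : filled_julia p w -> w = z by move=> /zw ->; rewrite -(zw z zK).
have pz : p.[z] = z by apply: Ksing; exact: filled_julia_horner.
have root_eq w : root (p - z%:P) w -> w = z.
  rewrite rootE !hornerE subr_eq0 => /eqP pw; apply: Ksing.
  by apply: (@filled_julia_iter 1); rewrite /= pw.
have szp : size (p - z%:P) = size p.
  by rewrite size_polyDl// size_polyN (leq_ltn_trans (size_polyC_leq1 _))// (ltn_trans _ hp).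
have /factor_theorem[u uE] : root (p - z%:P) z by rewrite rootE !hornerE pz subrr.
have p0 : p - z%:P != 0 by rewrite -size_poly_gt0 szp (ltn_trans _ hp).
have szu : size u != 1%N.
  apply/negP => /eqP u1; move: hp; rewrite -szp uE size_Mmonic ?monicXsubC//.
    by rewrite size_XsubC u1.
  by rewrite -size_poly_gt0 u1.
(* The cofactor [u] has a root, which must again be [z]: so [z] is a multiple root of [p - z], and
   [p] contracts distances to [z] nearby. *)
have [v vu] := closed_rootP u szu.
have vz : v = z by apply: root_eq; rewrite uE rootM vu.
have /factor_theorem[s sE] : root u z by rewrite -vz.
have pE w : p.[w] - z = (s * ('X - z%:P)).[w] * (w - z).
  by have := congr1 (horner^~ w) uE; rewrite sE /= !hornerE.
have : \forall w \near z, `|(s * ('X - z%:P)).[w]| < 1.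
  have := @horner_continuous C (s * ('X - z%:P)) z.
  rewrite /continuous_at hornerM hornerXsubC subrr mulr0 => /cvgrPdist_lt/(_ _ ltr01).
  by apply: filterS => w; rewrite sub0r normrN.
move=> /nbhs_ballP[d /= d0 dP].
have contract w : `|w - z| < d -> `|p.[w] - z| <= `|w - z|.
  move=> wd; rewrite pE normrM ler_piMl// ltW//; apply: dP.
  by rewrite -ball_normE /= distrC.
have stay w n' : `|w - z| < d -> `|p^[n'] w - z| <= `|w - z|.
  move=> wd; elim: n' => [//|k IH] /=.
  by apply: le_trans (contract _ _) _ => //; exact: le_lt_trans wd.
have de0 : 0 < d + e by rewrite addr_gt0.
(* A positive number below both [d] and [e], given by a formula since the order is partial. The
   point [z + h] has a bounded orbit and contradicts isolation. *)
pose h := d * e / (d + e); have h0 : 0 < h by rewrite divr_gt0// mulr_gt0.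
have hd : h < d by rewrite ltr_pdivrMr// ltr_pM2l// ltrDr.
have he : h < e by rewrite ltr_pdivrMr// mulrC ltr_pM2l// ltrDl.
have zh : `|z + h - z| = h by rewrite addrAC subrr add0r gtr0_norm.
suff /iso : filled_julia p (z + h).
  by rewrite zh => /(_ he)/eqP; rewrite -subr_eq0 addrAC subrr add0r gt_eqF.
apply: (@bounded_filled_julia _ (`|z| + h)) => k.
rewrite -[iter _ _ _](subrK z) (le_trans (ler_normD _ _))// addrC lerD2l.
by rewrite -{2}zh; apply: stay; rewrite zh.
Qed.

End FilledJulia.

(** * Two by two matrices and their eigenvalues *)

Section TwoByTwo.
Variable K : fieldType.
Implicit Types (M N : 'M[K]_2) (a b h x t : K) (q : {poly K}).

Lemma sum_ord2 (V : nmodType) (F : 'I_2 -> V) : \sum_i F i = F 0 + F 1.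
Proof.
rewrite !big_ord_recl big_ord0 addr0.
by congr (F _ + F _); apply: val_inj.
Qed.

Lemma mxtrace2 M : \tr M = M 0 0 + M 1 1.
Proof. exact: sum_ord2. Qed.

Lemma det_mx22 M : \det M = M 0 0 * M 1 1 - M 0 1 * M 1 0.
Proof.
rewrite (expand_det_row _ 0) !big_ord_recl big_ord0 addr0 /cofactor !det_mx11 !mxE /=.
rewrite !addn0 expr0 mul1r add0n expr1 mulN1r mulrN.
by congr (M _ _ * M _ _ - M _ _ * M _ _); apply: val_inj.
Qed.

Lemma det_sub_scalar_mx2 M x : \det (M - x%:M) = x ^+ 2 - \tr M * x + \det M.
Proof. by rewrite !det_mx22 mxtrace2 !mxE /=; ring. Qed.

Lemma sqr_mx2 M : M *m M = \tr M *: M - (\det M)%:M.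
Proof.
have e0 (j : 'I_2) : j = 0 \/ j = 1.
  by case: j => -[|[|//]] ?; [left|right]; apply: val_inj.
apply/matrixP => i j; rewrite det_mx22 mxtrace2 !mxE sum_ord2.
by case: (e0 i) => ->; case: (e0 j) => ->; rewrite /= ?mulr1n ?mulr0n;
  move: (M 0 0) (M 0 1) (M 1 0) (M 1 1) => *; ring.
Qed.

Lemma eigenvalue_det M a : eigenvalue M a = (\det (M - a%:M) == 0).
Proof.
apply/eigenvalueP/det0P => [[v vM v0]|[v v0 vM]]; exists v => //.
  by rewrite mulmxBr vM mul_mx_scalar subrr.
by apply/eqP; rewrite -subr_eq0 -mul_mx_scalar -mulmxBr vM.
Qed.

Lemma eigenvalue2E M a b : eigenvalue M a ->
  eigenvalue M b = (b == a) || (b == \tr M - a).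
Proof.
rewrite !eigenvalue_det !det_sub_scalar_mx2 => /eqP Ma.
rewrite -[X in X == 0]subr0 -{1}Ma -[b == a]subr_eq0 -[b == \tr M - a]subr_eq0 -mulf_eq0.
by congr (_ == 0); ring.
Qed.

Lemma det_sub_eigenvalue M a x : eigenvalue M a ->
  \det (M - x%:M) = (x - a) * (x - (\tr M - a)).
Proof.
rewrite eigenvalue_det => /eqP Ma; rewrite -[LHS]subr0 -{1}Ma !det_sub_scalar_mx2; ring.
Qed.

Lemma horner_mx_mulr_eigen N h q : N *m N = h *: N -> horner_mx N q *m N = q.[h] *: N.
Proof.
move=> NN; elim/poly_ind: q => [|q c IH]; first by rewrite rmorph0 mul0mx horner0 scale0r.
rewrite rmorphD rmorphM /= horner_mx_X horner_mx_C mulmxDl -mulmxA NN -scalemxAr IH.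
by rewrite mul_scalar_mx scalerA -scalerDl hornerMXaddC mulrC.
Qed.

Lemma take_poly1E q : take_poly 1 q = (q`_0)%:P.
Proof.
by rewrite /take_poly poly_def big_ord_recl big_ord0 addr0 expr0 alg_polyC.
Qed.

(* The divided difference of [q] between the two eigenvalues [a] and [a + h]. *)
Definition diff_quot q a := drop_poly 1 (q \Po ('X + a%:P)).

Lemma diff_quotE q a h : (diff_quot q a).[h] * h = q.[a + h] - q.[a].
Proof.
have -> : q.[a + h] = (q \Po ('X + a%:P)).[h].
  by rewrite horner_comp hornerD hornerX hornerC addrC.
rewrite -{1}(poly_take_drop 1 (q \Po _)) take_poly1E hornerD hornerM hornerXn expr1 hornerC.
by rewrite -horner_coef0 horner_comp !hornerE addrAC subrr add0r.
Qed.

(** By Cayley-Hamilton, [N = M - a] has determinant 0 and satisfies [N *m N = h *: N], where [h] is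
    its trace. After expanding [q] at [a], the tail evaluated at [N] and multiplied by [N] is its
    value at [h] times [N]. This includes [h = 0]. *)
Lemma horner_mx2E M a q : eigenvalue M a ->
  horner_mx M q = (q.[a])%:M + (diff_quot q a).[\tr M - a *+ 2] *: (M - a%:M).
Proof.
rewrite eigenvalue_det => /eqP Ma; set N := M - a%:M.
have NN : N *m N = (\tr M - a *+ 2) *: N.
  rewrite sqr_mx2 Ma -scalemx1 scale0r subr0 /N !mxtrace2 !mxE /=; congr (_ *: _).
  by rewrite !mulr1n; ring.
rewrite -horner_mx_mulr_eigen//.
have {1}-> : q = (q \Po ('X + a%:P)) \Po ('X - a%:P).
  by rewrite -comp_polyA comp_polyD comp_polyX comp_polyC subrK comp_polyXr.
rewrite horner_mx_comp rmorphB /= horner_mx_X horner_mx_C -/N.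
rewrite -{1}(poly_take_drop 1 (q \Po _)) rmorphD rmorphM /= expr1 horner_mx_X.
congr (_ + _).
by rewrite take_poly1E horner_mx_C -horner_coef0 horner_comp !hornerE.
Qed.

Lemma eigenvalue_horner_mx M a q : eigenvalue M a -> eigenvalue (horner_mx M q) q.[a].
Proof.
move=> /eigenvalueP[v vM v0]; apply/eigenvalueP; exists v => //.
elim/poly_ind: q => [|q c IH]; first by rewrite rmorph0 mulmx0 horner0 scale0r.
rewrite rmorphD rmorphM /= horner_mx_X horner_mx_C mulmxDr mulmxA IH -scalemxAl vM.
by rewrite mul_mx_scalar scalerA -scalerDl hornerMXaddC.
Qed.

(** For a left eigenvector [v] and a column [u] with [v *m u = 1], adding a multiple of [u *m v]
    moves the eigenvalue of [v] and the trace equally, so the other eigenvalue stays fixed. *)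
Lemma rank1_perturbation M a : eigenvalue M a -> exists D : 'M[K]_2,
  forall t, eigenvalue (M + t *: D) (a + t) /\ \tr (M + t *: D) = \tr M + t.
Proof.
move=> /eigenvalueP[v vM v0].
have [u uv] : exists u : 'cV_2, v *m u = 1%:M.
  have /rV0Pn[j vj] := v0; exists ((v 0 j)^-1 *: delta_mx j 0).
  by rewrite -scalemxAr -colE [col j v]mx11_scalar mxE scale_scalar_mx mulVf.
exists (u *m v) => t; split.
  apply/eigenvalueP; exists v => //.
  by rewrite mulmxDr vM -scalemxAr mulmxA uv mul1mx -scalerDl.
by rewrite mxtraceD mxtraceZ mxtrace_mulC uv mxtrace1 mulr1.
Qed.

End TwoByTwo.

Lemma eigenvalue_exists (F : closedFieldType) n (M : 'M[F]_n.+1) :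
  exists a, eigenvalue M a.
Proof.
have szM : size (char_poly M) != 1%N by rewrite size_char_poly.
by have [a ra] := closed_rootP _ szM; exists a; rewrite eigenvalue_root_char.
Qed.

(** * Continuity of the spectrum *)

Section Eigenvalues.
Variable R : realType.
Local Notation C := (Cplx R).
Implicit Types (M D : M2 R) (a b e : C).

Lemma eigenvalue_norm_le M a : eigenvalue M a -> `|a| <= 2 * `|M|.
Proof.
move=> /eigenvalueP[v vM v0]; rewrite -(ler_pM2r (_ : 0 < `|v|)) ?normr_gt0//.
by rewrite -normrZ -vM (le_trans (mulmx_norm_le _ _))// -mulrA [`|M| * _]mulrC.
Qed.

Lemma norm_scalar_mx2_le a : `|a%:M : M2 R| <= `|a|.
Proof.
apply: mx_norm_le_entries => // i j; rewrite mxE.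
by case: (i == j); rewrite ?mulr1n ?mulr0n ?normr0.
Qed.

Lemma coord_cvg M i j : (fun M' : M2 R => M' i j) @ M --> M i j.
Proof. exact: coord_continuous. Qed.

Lemma det2_continuous : continuous (fun M => \det M).
Proof.
move=> M; rewrite (_ : (fun M' : M2 R => \det M') =
    (fun M' : M2 R => M' 0 0 * M' 1 1 - M' 0 1 * M' 1 0)).
  apply: (@cvgB C C (M2 R) (nbhs M) _ (fun M' => M' 0 0 * M' 1 1) (fun M' => M' 0 1 * M' 1 0)).
    by apply: (@cvgM C (M2 R) (nbhs M) _ (fun M' => M' 0 0) (fun M' => M' 1 1)); exact: coord_cvg.
  by apply: (@cvgM C (M2 R) (nbhs M) _ (fun M' => M' 0 1) (fun M' => M' 1 0)); exact: coord_cvg.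
by apply/funext => M'; rewrite det_mx22.
Qed.

Lemma mxtrace2_continuous : continuous (fun M => \tr M).
Proof.
move=> M; rewrite (_ : (fun M' : M2 R => \tr M') = (fun M' : M2 R => M' 0 0 + M' 1 1)).
  by apply: (@cvgD C C (M2 R) (nbhs M) _ (fun M' => M' 0 0) (fun M' => M' 1 1)); exact: coord_cvg.
by apply/funext => M'; rewrite mxtrace2.
Qed.

Lemma mul_lt_sqr (x y e : C) : 0 < e -> `|x * y| < e ^+ 2 -> `|x| < e \/ `|y| < e.
Proof.
move=> e0 xy; apply: contrapT => /not_orP[/negP nx /negP ny].
move: xy; apply/negP; rewrite -(real_leNgt (rpredX _ (gtr0_real e0)) (normr_real _)).
rewrite normrM expr2 ler_pM ?(ltW e0)//.
  by rewrite (real_leNgt (gtr0_real e0) (normr_real _)).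
by rewrite (real_leNgt (gtr0_real e0) (normr_real _)).
Qed.

(** The characteristic polynomial of [M'] at [a] is close to 0 and is the product of the differences
    between [a] and the two eigenvalues of [M']; if it is below [e ^+ 2], one factor is below
    [e]. *)
Lemma eigenvalue_near M a e : eigenvalue M a -> 0 < e ->
  \forall M' \near M, exists2 b, eigenvalue M' b & `|b - a| < e.
Proof.
move=> Ma e0; have e20 : 0 < e ^+ 2 by rewrite exprn_gt0.
have cv : (fun M' : M2 R => a ^+ 2 - \tr M' * a + \det M') @ M --> a ^+ 2 - \tr M * a + \det M.
  apply: (@cvgD C C (M2 R) (nbhs M) _ (fun M' => a ^+ 2 - \tr M' * a) (fun M' => \det M')).
    apply: (@cvgB C C (M2 R) (nbhs M) _ (cst (a ^+ 2)) (fun M' => \tr M' * a)); first exact: cvg_cst.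
    apply: (@cvgM C (M2 R) (nbhs M) _ (fun M' => \tr M') (cst a)); last exact: cvg_cst.
    exact: mxtrace2_continuous.
  exact: det2_continuous.
have /cvgrPdist_lt/(_ _ e20) := cv.
apply: filterS => M'; rewrite -!det_sub_scalar_mx2.
have /eqP -> : \det (M - a%:M) == 0 by rewrite -eigenvalue_det.
rewrite sub0r normrN; have [b Mb] := eigenvalue_exists M'.
rewrite (det_sub_eigenvalue _ Mb) => /(mul_lt_sqr e0)[ab|ab].
  by exists b => //; rewrite distrC.
exists (\tr M' - b); last by rewrite distrC.
by rewrite (eigenvalue2E _ Mb) eqxx orbT.
Qed.

Lemma near_eigenvalue M e : 0 < e ->
  \forall M' \near M, forall b, eigenvalue M' b -> exists2 a, eigenvalue M a & `|b - a| < e.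
Proof.
(* Here the characteristic polynomial of [M] is evaluated at eigenvalues [b] of nearby matrices; [c]
   bounds all of them. *)
move=> e0; pose c := 2 * (`|M| + 1).
have c0 : 0 < c by rewrite mulr_gt0// ltr_wpDl.
have e2 : 0 < e ^+ 2 / 2 by rewrite divr_gt0// exprn_gt0.
have /cvgrPdist_lt/(_ _ (divr_gt0 e2 c0)) ntr := @mxtrace2_continuous M.
have /cvgrPdist_lt/(_ _ e2) ndet := @det2_continuous M.
have nM : \forall M' \near M, `|M'| <= `|M| + 1.
  apply: filterS (nbhsx_ballx M _ ltr01) => M'; rewrite -ball_normE /= distrC => /ltW MM'.
  by rewrite -lerBlDl (le_trans (lerB_dist _ _)).
apply: filterS3 ntr ndet nM => M' tM' dM' bM' b M'b.
have [a Ma] := eigenvalue_exists M.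
have bc : `|b| <= c by rewrite (le_trans (eigenvalue_norm_le M'b))// ler_pM2l.
have : `|(b - a) * (b - (\tr M - a))| < e ^+ 2.
  rewrite -det_sub_eigenvalue// -[\det _]subr0.
  have /eqP <- : \det (M' - b%:M) == 0 by rewrite -eigenvalue_det.
  rewrite !det_sub_scalar_mx2.
  rewrite (_ : _ - _ = (\det M - \det M') - (\tr M - \tr M') * b); last by ring.
  rewrite (le_lt_trans (ler_normB _ _))// [ltRHS]splitr ltrD// normrM.
  apply: (@le_lt_trans _ _ (`|\tr M - \tr M'| * c)); first exact: ler_wpM2l.
  by rewrite -ltr_pdivlMr.
move=> /(mul_lt_sqr e0)[ab|ab]; first by exists a; [exact: Ma|exact: ab].
exists (\tr M - a); last exact: ab.
by rewrite (eigenvalue2E _ Ma) eqxx orbT.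
Qed.

End Eigenvalues.

(** * Iteration of matrices *)

Section HornerMatrix.
Variables (R : realType) (n : nat).
Local Notation C := (Cplx R).
Local Notation V := 'M[C]_n.+1.
Implicit Types (M : V) (q : {poly C}).

Lemma line_poly_horner_mx q : line_poly (fun M => horner_mx M q).
Proof.
elim/poly_ind: q => [|q c IH] x.
  exists (\0 : {linear V -> V}) => h i j; exists 0; rewrite !coef0 rmorph0 !mxE.
  by split => // t; rewrite rmorph0 mxE horner0.
have [l lP] := IH x.
(* The product rule for [M |-> q(M) M]. *)
have lin : linear (fun h => l h *m x + horner_mx x q *m h).
  move=> a u v; rewrite linearP mulmxDl -scalemxAl mulmxDr -scalemxAr.
  by rewrite scalerDr addrACA.
have [l' l'E] := linear_of_fun lin.
exists l' => h i j; rewrite l'E.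
have [s sP] := choice (fun k => lP h i k).
exists (\sum_k s k * ((x k j)%:P + h k j *: 'X) + (c *+ (i == j))%:P).
have XE M : horner_mx M (q * 'X + c%:P) i j = \sum_k horner_mx M q i k * M k j + c *+ (i == j).
  by rewrite rmorphD rmorphM /= horner_mx_X horner_mx_C !mxE.
split.
- rewrite coefD coefC eqxx coef_sum XE; congr (_ + _); apply: eq_bigr => k _.
  have [s0 _ _] := sP k.
  by rewrite coefM big_ord_recl big_ord0 addr0 /= coefD coefC coefZ coefX mulr0 addr0 s0.
- rewrite coefD coefC addr0 coef_sum !mxE -big_split /=; apply: eq_bigr => k _.
  have [s0 s1 _] := sP k.
  rewrite coefM !big_ord_recl big_ord0 addr0 /= !coefD !coefC !coefZ !coefX /= mulr0 mulr1.
  by rewrite addr0 add0r s0 s1 addrC.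
- move=> t; rewrite XE hornerD hornerC horner_sum; congr (_ + _); apply: eq_bigr => k _.
  have [_ _ ->] := sP k.
  by rewrite !mxE hornerM hornerD hornerC hornerZ hornerX [t * _]mulrC.
Qed.

Lemma horner_mx_bounded q (b : C) : 0 <= b ->
  exists2 B : C, 0 <= B & forall M, `|M| <= b -> `|horner_mx M q| <= B.
Proof.
move=> b0; elim/poly_ind: q => [|q c [B B0 BP]].
  by exists 0 => // M _; rewrite rmorph0 normr0.
exists (n.+1%:R * (B * b) + `|c%:M : V|) => [|M Mb]; first by rewrite !(addr_ge0, mulr_ge0).
rewrite rmorphD rmorphM /= horner_mx_X horner_mx_C (le_trans (ler_normD _ _))// lerD2r.
rewrite (le_trans (mulmx_norm_le _ _))// ler_wpM2l// ler_pM//; exact: BP.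
Qed.

End HornerMatrix.

Lemma iter_mx_poly (R : realType) (p : {poly Cplx R}) n M :
  iter n (mx_poly p) M = horner_mx M (iter_poly p n).
Proof.
elim: n => [|n IH] /=; first by rewrite horner_mx_X.
by rewrite IH /mx_poly horner_mx_comp.
Qed.

(** * Bounded orbits and normality in terms of eigenvalues *)

Section MatrixDynamics.
Variables (R : realType) (p : {poly Cplx R}).
Local Notation C := (Cplx R).
Variable rho : C.
Hypotheses (rho1 : 1 <= rho) (rhoP : forall z, rho < `|z| -> 2 * `|z| <= `|p.[z]|).
Hypothesis hp : (2 < size p)%N.
Implicit Types (M D : M2 R) (a b e : C).
Local Notation Kp := (filled_julia p).
Local Notation KP := (mx_filled_julia p).
Local Notation P n := (iter n (mx_poly p)).

Let rho0 : 0 < rho. Proof. exact: lt_le_trans rho1. Qed.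

Definition eig_in (A : set C) : set (M2 R) := [set M | forall a, eigenvalue M a -> A a].

Lemma eigenvalue_iter_le M a n : eigenvalue M a -> `|iter n (horner p) a| <= 2 * `|P n M|.
Proof.
move=> Ma; rewrite -horner_iter_poly iter_mx_poly.
exact/eigenvalue_norm_le/eigenvalue_horner_mx.
Qed.

Lemma mx_filled_julia_eig M : KP M -> eig_in Kp M.
Proof.
(* The bound on [P^n(M)] starts at [n = 1], so membership in [K_p] is shown for the image of [a] and
   pulled back. *)
move=> [B [Br BP]] a Ma; apply: (filled_julia_iter rho1 rhoP (n := 1)).
apply: (@bounded_filled_julia _ _ _ (2 * (B + 1))) => n; rewrite -iterD addn1.
rewrite (le_trans (eigenvalue_iter_le n.+1 Ma))// ler_pM2l//.
by apply: (BP (B + 1)); [rewrite ltrDl|exists n.+1].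
Qed.

Lemma norm_iter_le M a n : eigenvalue M a -> Kp a ->
  `|P n M| <= rho + `|(diff_quot (iter_poly p n) a).[\tr M - a *+ 2]| * `|M - a%:M|.
Proof.
move=> Ma /(filled_juliaP rho1 rhoP) Ka; rewrite iter_mx_poly (horner_mx2E _ Ma).
rewrite (le_trans (ler_normD _ _))// lerD ?normrZ//.
by rewrite (le_trans (norm_scalar_mx2_le _))// horner_iter_poly.
Qed.

Lemma diff_quot_iter_le M a n : eigenvalue M a -> eig_in Kp M ->
  `|(diff_quot (iter_poly p n) a).[\tr M - a *+ 2]| * `|\tr M - a *+ 2| <= 2 * rho.
Proof.
move=> Ma MK; rewrite -normrM diff_quotE.
have Mb : eigenvalue M (a + (\tr M - a *+ 2)).
  by rewrite (eigenvalue2E _ Ma) mulr2n opprD addrC addrA subrK eqxx orbT.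
rewrite (le_trans (ler_normB _ _))// mulr_natl mulr2n !horner_iter_poly lerD//.
  by have /(filled_juliaP rho1 rhoP) := MK _ Mb; exact.
by have /(filled_juliaP rho1 rhoP) := MK _ Ma; exact.
Qed.

Lemma distinct_eig_mx_filled_julia M a : eig_in Kp M -> eigenvalue M a ->
  \tr M - a *+ 2 != 0 -> KP M.
Proof.
move=> MK Ma h0; pose B := rho + 2 * rho / `|\tr M - a *+ 2| * `|M - a%:M|.
have hn : 0 < `|\tr M - a *+ 2| by rewrite normr_gt0.
have B0 : 0 <= B by rewrite addr_ge0 ?mulr_ge0 ?invr_ge0// ltW.
exists B; split=> [|A BA _ [n _ <-]] /=; first exact: ger0_real.
apply: le_trans (ltW BA); apply: (le_trans (norm_iter_le n Ma (MK _ Ma))).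
by rewrite lerD2l ler_wpM2r// ler_pdivlMr// diff_quot_iter_le.
Qed.

Lemma small_multiple_near (D M : M2 R) (A : set (M2 R)) : nbhs M A ->
  exists2 e : C, 0 < e & forall t, `|t| < e -> A (M + t *: D).
Proof.
move=> /nbhs_ballP[d /= d0 dA]; exists (d / (`|D| + 1)).
  by rewrite divr_gt0// ltr_wpDl.
move=> t; rewrite ltr_pdivlMr ?ltr_wpDl// => td; apply: dA; rewrite -ball_normE /=.
rewrite opprD addrA subrr add0r normrN normrZ (le_lt_trans _ td)//.
by rewrite ler_wpM2l// lerDl.
Qed.

Lemma closed_eig_in_filled_julia : closed (eig_in Kp).
Proof.
move=> M clM a Ma; apply: contrapT => /(escape_near rho1 rhoP)[N].
move=> /nbhs_ballP[d /= d0 dN].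
have [M' [M'K [b M'b ba]]] := clM _ (eigenvalue_near Ma d0).
have : rho < `|iter N (horner p) b| by apply: dN; rewrite -ball_normE /= distrC.
by move=> /lt_le_trans/(_ ((filled_juliaP rho1 rhoP _).1 (M'K _ M'b) N)); rewrite ltxx.
Qed.

Lemma closure_mx_filled_julia : closure KP = eig_in Kp.
Proof.
apply/seteqP; split.
  rewrite [X in _ `<=` X](closure_id _).1; last exact: closed_eig_in_filled_julia.
  by apply: closureS => M; exact: mx_filled_julia_eig.
move=> M MK; have [a Ma] := eigenvalue_exists M.
have [h0|h0] := eqVneq (\tr M - a *+ 2) 0; last first.
  by apply: subset_closure; exact: (distinct_eig_mx_filled_julia MK Ma).
(* The double eigenvalue [a] is split into [a] and a nearby point [w] of [K_p]. *)
move=> A MA; have [D DP] := rank1_perturbation Ma.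
have [e e0 eA] := small_multiple_near D MA.
have [w [wK wa we]] := filled_julia_perfect rho1 rhoP hp (MK _ Ma) e0.
have [Mt tr] := DP (w - a); rewrite [a + _]addrC subrK in Mt.
exists (M + (w - a) *: D); split; last exact: eA.
have trM : \tr M = a *+ 2 by apply/eqP; rewrite -subr_eq0 h0.
apply: (distinct_eig_mx_filled_julia _ Mt).
  move=> b; rewrite (eigenvalue2E _ Mt) tr trM => /orP[/eqP->//|/eqP->].
  rewrite (_ : _ - w = a); first exact: (MK _ Ma).
  by rewrite mulr2n; ring.
rewrite tr trM (_ : _ - _ = a - w); last by rewrite !mulr2n; ring.
by rewrite subr_eq0 eq_sym.
Qed.

(** One radius for all eigenvalues of all nearby matrices, as Cauchy's estimate requires. Half of
    the room around the eigenvalues of [M] is spent on their displacement. *)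
Lemma eig_disc_near M : eig_in Kp^° M -> exists2 s : C, 0 < s &
  \forall M' \near M, forall b, eigenvalue M' b -> forall z, `|z - b| <= s -> Kp z.
Proof.
move=> MK; have [a Ma] := eigenvalue_exists M.
have Mb : eigenvalue M (\tr M - a) by rewrite (eigenvalue2E _ Ma) eqxx orbT.
have /nbhs_ballP[d /= d0 dK] := MK _ Ma.
have /nbhs_ballP[e /= e0 eK] := MK _ Mb.
pose s := d * e / (d + e); have de0 : 0 < d + e by rewrite addr_gt0.
have s0 : 0 < s by rewrite divr_gt0// mulr_gt0.
have sd : s < d by rewrite ltr_pdivrMr// ltr_pM2l// ltrDr.
have se : s < e by rewrite ltr_pdivrMr// mulrC ltr_pM2l// ltrDl.
have s20 : 0 < s / 2 by rewrite divr_gt0.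
exists (s / 2) => //; apply: filterS (near_eigenvalue M s20) => M' M'P b /M'P[c Mc bc] z zb.
have zc : `|z - c| < s.
  rewrite -(subrK b z) -addrA (le_lt_trans (ler_normD _ _))// [ltRHS]splitr.
  exact: ler_ltD.
move: Mc zc; rewrite (eigenvalue2E _ Ma) => /orP[/eqP->|/eqP->] zc.
  by apply: dK; rewrite -ball_normE /= distrC (lt_trans zc).
by apply: eK; rewrite -ball_normE /= distrC (lt_trans zc).
Qed.

(** If a neighbourhood of [M] lies in [E], rank-one perturbations carry the eigenvalue [a] to every
    nearby point, so [a] is interior to [K_p]. The converse is continuity of the spectrum. *)
Lemma interior_eig_in : (eig_in Kp)^° = eig_in Kp^°.
Proof.
apply/seteqP; split=> M.
  move=> MK a Ma; have [D DP] := rank1_perturbation Ma.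
  have [e e0 eK] := small_multiple_near D MK.
  apply/nbhs_ballP; exists e => //= w; rewrite -ball_normE /= distrC => /eK; apply.
  by have [+ _] := DP (w - a); rewrite [a + _]addrC subrK.
move=> /eig_disc_near[s s0]; apply: filterS => M' M'K b M'b.
by apply: (M'K _ M'b); rewrite subrr normr0 ltW.
Qed.

Lemma iter_bounded_near M0 : (eig_in Kp)^° M0 -> exists r B : C,
  [/\ 0 < r, 0 < B & forall n M, `|M - M0| <= r * 2 -> `|P n M| <= B].
Proof.
rewrite interior_eig_in => /eig_disc_near[s s0 /nbhs_ballP[d /= d0 dK]].
pose m := `|M0| + d; have m0 : 0 < m by rewrite ltr_wpDl.
have d4 : d / 4 * 2 < d.
  by rewrite mulrAC ltr_pdivrMr// ltr_pM2l// ltr_nat.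
(* The doubled radius stays below [d], as Montel's theorem needs; [4 * rho / s] bounds the divided
   difference and [3 * m] the norm of [M - a]. *)
exists (d / 4), (rho + 4 * rho / s * (3 * m)); split.
- by rewrite divr_gt0.
- by rewrite addr_gt0 ?mulr_gt0 ?invr_gt0.
move=> n M MM0; have {}MM0 : `|M - M0| < d by exact: le_lt_trans d4.
have MK z b : eigenvalue M b -> `|z - b| <= s -> Kp z.
  by move=> Mb; apply: (dK M _ b Mb); rewrite -ball_normE /= distrC.
have ME : eig_in Kp M by move=> b Mb; apply: (MK _ _ Mb); rewrite subrr normr0 ltW.
have [a Ma] := eigenvalue_exists M.
have Mm : `|M| <= m.
  by rewrite -(subrK M0 M) (le_trans (ler_normD _ _))// addrC lerD2l ltW.
apply: (le_trans (norm_iter_le n Ma (ME _ Ma))); rewrite lerD2l ler_pM//; last first.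
  rewrite (le_trans (ler_normB _ _))// (_ : 3 * m = m + 2 * m); last by ring.
  rewrite lerD// (le_trans (norm_scalar_mx2_le _))// (le_trans (eigenvalue_norm_le Ma))//.
  by rewrite ler_pM2l.
set h := \tr M - a *+ 2; rewrite ler_pdivlMr//.
have s20 : 0 < s / 2 by rewrite divr_gt0.
(* Close eigenvalues: Cauchy's estimate on the disc of radius [s] about [a]. Separated eigenvalues:
   the difference of two values in the disc of radius [rho], divided by [h]. *)
have [hs|sh] := boolP (`|h| <= s / 2).
  apply: (@le_trans _ _ (2 * rho)); last by rewrite ler_pM2r// ler_nat.
  rewrite -[s in _ * s]expr1; apply: drop_poly_disc_bound => // t ts.
  rewrite horner_comp !hornerE horner_iter_poly.
  have /(filled_juliaP rho1 rhoP) : Kp (t + a) by apply: (MK _ _ Ma); rewrite addrK ts.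
  exact.
have {}sh : s <= `|h| * 2.
  rewrite -ler_pdivrMr// ltW// (real_ltNge (gtr0_real s20) (normr_real _)).
  exact: sh.
rewrite (le_trans (ler_wpM2l _ sh))// mulrA (_ : 4 * rho = 2 * rho * 2); last by ring.
by rewrite ler_pM2r// diff_quot_iter_le.
Qed.

Lemma iter_bounded_upto N (b : C) : 0 <= b ->
  exists2 B : C, 0 < B & forall n M, (n < N)%N -> `|M| <= b -> `|P n M| <= B.
Proof.
move=> b0; elim: N => [|N [B B0 BP]]; first by exists 1.
have [B' B'0 B'P] := horner_mx_bounded 1 (iter_poly p N) b0.
exists (B + B') => [|n M]; first by rewrite ltr_pwDl.
rewrite ltnS leq_eqVlt => /orP[/eqP->|nN] Mb.
  by rewrite iter_mx_poly (le_trans (B'P _ Mb))// lerDr ltW.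
by rewrite (le_trans (BP _ _ nN Mb))// lerDl.
Qed.

Lemma escape_eig_near M0 : ~ eig_in Kp M0 -> exists N, exists2 r : C, 0 < r &
  forall M, `|M - M0| < r -> exists2 b, eigenvalue M b & rho < `|iter N (horner p) b|.
Proof.
move=> /existsNP[a /not_implyP[Ma /(escape_near rho1 rhoP)[N]]].
move=> /nbhs_ballP[d /= d0 dN]; exists N.
have /nbhs_ballP[r /= r0 rP] := eigenvalue_near Ma d0.
exists r => // M MM0; have [|b Mb ba] := rP M; first by rewrite -ball_normE /= distrC.
by exists b; [exact: Mb|apply: dN; rewrite -ball_normE /= distrC].
Qed.

Local Notation iterates := [set P n | n in [set n | (1 <= n)%N]].

Lemma open_nbhs_norm_ball M0 (r : C) : 0 < r -> open_nbhs M0 [set M : M2 R | `|M - M0| < r].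
Proof.
move=> r0; have -> : [set M : M2 R | `|M - M0| < r] = ball M0 r.
  by rewrite -ball_normE; apply/seteqP; split=> M /=; rewrite distrC.
by split; [exact: ball_open|exact: ballxx].
Qed.

Lemma line_poly_iter n : line_poly (P n).
Proof.
have -> : P n = (fun M => horner_mx M (iter_poly p n)).
  by apply/funext => M; rewrite iter_mx_poly.
exact: line_poly_horner_mx.
Qed.

Lemma interior_eig_fatou : (eig_in Kp)^° `<=` mx_fatou p.
Proof.
move=> M0 /iter_bounded_near[r [B [r0 B0 PB]]].
exists [set M | `|M - M0| < r / 4]; split.
  by apply: open_nbhs_norm_ball; rewrite divr_gt0.
move=> u uP.
have u_line k : line_poly (u k) by have [n _ <-] := uP k; exact: line_poly_iter.
have uB k y : `|y - M0| <= r * 2 -> `|u k y| <= B.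
  by have [n _ <-] := uP k; exact: PB.
by have [s [s_homo g]] := montel r0 B0 u_line uB; exists s; split => //; left.
Qed.

(** A sequence from the family may have indices in any order. If they are bounded from some rank on,
    the maps are locally bounded and a subsequence converges; otherwise a subsequence has indices
    tending to infinity and diverges. *)
Lemma escape_fatou : ~` eig_in Kp `<=` mx_fatou p.
Proof.
move=> M0 /escape_eig_near[N [r r0 rP]].
exists [set M | `|M - M0| < r / 4]; split.
  by apply: open_nbhs_norm_ball; rewrite divr_gt0.
move=> u uP.
have mex k : exists n, P n = u k by have [n _ nE] := uP k; exists n.
have [m mP] := choice mex.
(* A single [K] serves as rank and as bound, so the negation provides arbitrarily late terms of
   arbitrarily large index. *)
have [[K mK]|unb] := pselect (exists K, forall n, (K <= n)%N -> (m n < K)%N).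
  have b0 : 0 <= `|M0| + r * 2 by rewrite addr_ge0// mulr_ge0// ltW.
  have [B B0 BP] := iter_bounded_upto K b0.
  pose f k := u (k + K)%N.
  have f_line k : line_poly (f k) by rewrite /f -(mP (k + K)%N); exact: line_poly_iter.
  have fB k y : `|y - M0| <= r * 2 -> `|f k y| <= B.
    move=> yr; rewrite /f -(mP (k + K)%N); apply: BP; first by rewrite mK ?leq_addl.
    by rewrite -(subrK M0 y) (le_trans (ler_normD _ _))// addrC lerD2l.
  have [s [s_homo g]] := montel r0 B0 f_line fB.
  exists (fun k => s k + K)%N; split; last by left.
  by move=> i j ij; rewrite ltn_add2r s_homo.
have Fex K : exists n, (K <= n)%N && (K <= m n)%N.
  apply: contrapT => nF; apply: unb; exists K => n Kn; rewrite ltnNge; apply/negP => Kmn.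
  by apply: nF; exists n; rewrite Kn.
have [F FP] := choice Fex.
pose s := fix s k := if k is k'.+1 then F (s k').+1 else F 0%N.
have s_lt k : (s k < s k.+1)%N by have /andP[] := FP (s k).+1.
have s_ge k : (k <= s k)%N by elim: k => // k IH; exact: leq_ltn_trans (s_lt k).
have ms k : (k <= m (s k))%N.
  by case: k => // k; have /andP[_] := FP (s k).+1; apply: leq_ltn_trans.
exists s; split; first by apply: homo_ltn s_lt; exact: ltn_trans.
(* The factor 2 compensates for the bound of an eigenvalue by twice the matrix norm. *)
right=> K _ KU A Ar.
have A2 : 2 * A \is Num.real by apply: rpredM => //; exact: (realn _ 2).
have [n0 _ n0P] := escape_uniform rho1 rhoP N A2.
exists n0 => // n /= n0n x /KU /= xU.
have [|b xb bN] := rP x; first by rewrite (lt_trans xU)// ltr_pdivrMr// ltr_pMr// ltr1n.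
rewrite -(mP (s n)) -(ltr_pM2l (_ : 0 < 2))//.
apply: lt_le_trans (eigenvalue_iter_le _ xb).
exact: (n0P _ (leq_trans n0n (ms n)) _ bN).
Qed.

(** Singletons are compact, so both alternatives can be tested at one matrix: divergence at a member
    of [K_P], convergence at a matrix outside [E]. The orbit of [M0] itself may be unbounded, hence
    the recourse to the density of [K_P] in [E]. *)
Lemma boundary_not_fatou M0 : eig_in Kp M0 -> ~ (eig_in Kp)^° M0 -> ~ mx_fatou p M0.
Proof.
move=> M0K M0i [U [[Uo UM0] /(_ (fun n => P n.+1))]] [n|s [s_homo]]; first by exists n.+1.
have Unb : nbhs M0 U by exact: open_nbhs_nbhs.
have s_ge k : (k <= s k)%N.
  by elim: k => // k IH; apply: leq_ltn_trans IH _; exact: s_homo.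
case=> [[g [_ gU]]|sdiv]; last first.
  have : closure KP M0 by rewrite closure_mx_filled_julia.
  move=> /(_ _ Unb)[M [[B [Br BP]] MU]].
  have B1r : B + 1 \is Num.real by rewrite rpredD ?rpred1.
  have MU1 : [set M] `<=` U by move=> _ ->.
  have [n _ nP] := sdiv _ (@compact_set1 _ M) MU1 (B + 1) B1r.
  have := nP n (leqnn n) M erefl; apply/negP.
  rewrite -(real_leNgt (normr_real _) B1r).
  by apply: (BP (B + 1)); [rewrite ltrDl|exists (s n).+1].
have [M1 M1U M1K] : exists2 M1, U M1 & ~ eig_in Kp M1.
  apply: contrapT => UK; apply: M0i; apply: filterS Unb => M MU.
  by apply: contrapT => MK; apply: UK; exists M.
have MU1 : [set M1] `<=` U by move=> _ ->.
have := gU _ (@compact_set1 _ M1) MU1; rewrite uniform_set1.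
move=> /cvgrPdist_lt/(_ _ ltr01)[n1 _ n1P].
have [N [r r0 /(_ M1)]] := escape_eig_near M1K.
rewrite subrr normr0 => /(_ r0)[b M1b bN].
have A2 : 2 * (`|g M1| + 1) \is Num.real by rewrite gtr0_real// mulr_gt0// ltr_wpDl.
have [n0 _ n0P] := escape_uniform rho1 rhoP N A2.
pose k := maxn n0 n1.
have : 2 * (`|g M1| + 1) < 2 * `|P (s k).+1 M1|.
  apply: lt_le_trans (eigenvalue_iter_le _ M1b); apply: (n0P _ _ _ bN) => /=.
  exact: leq_trans (leq_maxl n0 n1) (leqW (s_ge k)).
have two0 : 0 < 2 :> C by rewrite ltr0n.
rewrite (ltr_pM2l two0); apply/negP.
rewrite -(real_leNgt (normr_real _) (gtr0_real (ltr_wpDl (normr_ge0 _) ltr01))).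
have := ltW (n1P k (leq_maxr _ _)); rewrite /= distrC => H.
by rewrite -lerBlDl (le_trans (lerB_dist _ _)).
Qed.

Lemma mx_juliaE : mx_julia p = eig_in Kp `\` (eig_in Kp)^°.
Proof.
apply/seteqP; split=> M.
  move=> MJ; split; first by apply: contrapT => MK; apply: MJ; exact: escape_fatou.
  by move=> MK; apply: MJ; exact: interior_eig_fatou.
by move=> [MK Mi]; exact: boundary_not_fatou.
Qed.

Lemma boundary_closure_mx_filled_julia :
  boundary (closure KP) = eig_in Kp `\` (eig_in Kp)^°.
Proof.
rewrite /boundary closure_mx_filled_julia -(closure_id _).1//.
exact: closed_eig_in_filled_julia.
Qed.

End MatrixDynamics.

(** * Normal forms *)

Section NormalForm.
Variable R : realType.
Local Notation C := (Cplx R).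
Implicit Types (M Q X : M2 R) (a b l : C).

Definition mx22 (a b c d : C) : M2 R :=
  \matrix_(i, j) if i == 0 then if j == 0 then a else b else if j == 0 then c else d.

Lemma ord2P (T : 'I_2 -> Prop) : T 0 -> T 1 -> forall i, T i.
Proof.
move=> T0 T1 [[|[|//]] i2].
  by rewrite (_ : Ordinal i2 = 0)//; apply: val_inj.
by rewrite (_ : Ordinal i2 = 1)//; apply: val_inj.
Qed.

Lemma mx22E M : M = mx22 (M 0 0) (M 0 1) (M 1 0) (M 1 1).
Proof. by apply/matrixP; apply: ord2P; apply: ord2P; rewrite !mxE. Qed.

Lemma mul_mx22 a b c d a' b' c' d' : mx22 a b c d *m mx22 a' b' c' d' =
  mx22 (a * a' + b * c') (a * b' + b * d') (c * a' + d * c') (c * b' + d * d').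
Proof. by apply/matrixP; apply: ord2P; apply: ord2P; rewrite !mxE sum_ord2 !mxE. Qed.

Lemma det_mx22E a b c d : \det (mx22 a b c d) = a * d - b * c.
Proof. by rewrite det_mx22 !mxE. Qed.

Lemma diag2E a b : diag2 a b = mx22 a 0 0 b.
Proof. by apply/matrixP; apply: ord2P; apply: ord2P; rewrite !mxE. Qed.

Lemma jordan2E a : jordan2 a = mx22 a 1 0 a.
Proof. by apply/matrixP; apply: ord2P; apply: ord2P; rewrite !mxE. Qed.

Lemma similar_of_mulmx M Q X : \det Q != 0 -> M *m Q = Q *m X ->
  Q \in unitmx /\ M = Q *m X *m invmx Q.
Proof.
move=> Q0 MQ; have Qu : Q \in unitmx by rewrite unitmxE unitfE.
by rewrite -MQ mulmxK.
Qed.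

(* If an off-diagonal entry of [M] is nonzero, say in column [j], then [e_j] is a cyclic
   vector, and [(M - a) e_j] is an eigenvector for the other eigenvalue. *)
Lemma mx2_normal_form M : exists Q, Q \in unitmx /\
  ((exists a b, M = Q *m diag2 a b *m invmx Q) \/
   (exists a, M = Q *m jordan2 a *m invmx Q)).
Proof.
have [a Ma] := eigenvalue_exists M.
have : \det (M - a%:M) = 0 by apply/eqP; rewrite -eigenvalue_det.
rewrite det_sub_scalar_mx2 mxtrace2 det_mx22 {Ma}.
rewrite [in X in _ -> X](mx22E M).
move: (M 0 0) (M 0 1) (M 1 0) (M 1 1) => x y z w Ha.
pose b := x + w - a; have wE : w = a + b - x by rewrite /b; ring.
(* The characteristic equation with the entry [w] eliminated in favour of the second eigenvalue [b];
   all conjugation identities below reduce to it. *)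
have yz : y * z = (a - x) * (x - b).
  by apply/eqP; rewrite -subr_eq0 -oppr_eq0 -Ha wE; apply/eqP; ring.
have zy : z * y = (a - x) * (x - b) by rewrite mulrC.
clearbody b; rewrite {}wE {w Ha}; have [ab|ab] := eqVneq a b.
- rewrite -{b}ab in yz zy *; have [z0|z0] := eqVneq z 0; last first.
    have [||Qu QE] :=
        @similar_of_mulmx (mx22 x y z (a + a - x)) (mx22 (x - a) 1 z 0) (jordan2 a).
    + by rewrite det_mx22E mulr0 mul1r sub0r oppr_eq0.
    + by rewrite jordan2E !mul_mx22; congr mx22; rewrite ?yz; ring.
    by exists (mx22 (x - a) 1 z 0); split => //; right; exists a.
  have [y0|y0] := eqVneq y 0; last first.
    have [||Qu QE] :=
        @similar_of_mulmx (mx22 x y z (a + a - x)) (mx22 y 0 (a - x) 1) (jordan2 a).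
    + by rewrite det_mx22E mulr1 mul0r subr0.
    + by rewrite jordan2E !mul_mx22; congr mx22; rewrite ?zy; ring.
    by exists (mx22 y 0 (a - x) 1); split => //; right; exists a.
  exists 1%:M; rewrite unitmx1; split => //; left; exists x, (a + a - x).
  by rewrite mul1mx invmx1 mulmx1 diag2E z0 y0.
have [z0|z0] := eqVneq z 0; last first.
  have [||Qu QE] :=
      @similar_of_mulmx (mx22 x y z (a + b - x)) (mx22 (x - b) (x - a) z z) (diag2 a b).
  + by rewrite det_mx22E -mulrBl mulf_neq0// opprB addrC addrA subrK subr_eq0.
  + by rewrite diag2E !mul_mx22; congr mx22; rewrite ?yz; ring.
  by exists (mx22 (x - b) (x - a) z z); split => //; left; exists a, b.
have [y0|y0] := eqVneq y 0; last first.
  have [||Qu QE] :=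
      @similar_of_mulmx (mx22 x y z (a + b - x)) (mx22 y y (a - x) (b - x)) (diag2 a b).
  + rewrite det_mx22E -mulrBr mulf_neq0// opprB addrA subrK subr_eq0 eq_sym; exact: ab.
  + by rewrite diag2E !mul_mx22; congr mx22; rewrite ?zy; ring.
  by exists (mx22 y y (a - x) (b - x)); split => //; left; exists a, b.
exists 1%:M; rewrite unitmx1; split => //; left; exists x, (a + b - x).
by rewrite mul1mx invmx1 mulmx1 diag2E z0 y0.
Qed.

Lemma eigenvalue_conj Q X a : Q \in unitmx ->
  eigenvalue (Q *m X *m invmx Q) a = eigenvalue X a.
Proof.
move=> Qu; rewrite !eigenvalue_det.
have -> : Q *m X *m invmx Q - a%:M = Q *m (X - a%:M) *m invmx Q.
  by rewrite mulmxBr mulmxBl mul_mx_scalar -scalemxAl mulmxV// scalemx1.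
by rewrite !det_mulmx mulrAC -det_mulmx mulmxV// det1 mul1r.
Qed.

Lemma eigenvalue_diag2 l1 l2 a : eigenvalue (diag2 l1 l2) a = (a == l1) || (a == l2).
Proof.
rewrite eigenvalue_det det_sub_scalar_mx2 diag2E det_mx22E mxtrace2 !mxE /=.
rewrite -[a == l1]subr_eq0 -[a == l2]subr_eq0 -mulf_eq0; congr (_ == 0); ring.
Qed.

Lemma eigenvalue_jordan2 l a : eigenvalue (jordan2 l) a = (a == l).
Proof.
rewrite eigenvalue_det det_sub_scalar_mx2 jordan2E det_mx22E mxtrace2 !mxE /=.
by rewrite -[a == l]subr_eq0 -[RHS]sqrf_eq0; congr (_ == 0); ring.
Qed.

End NormalForm.

Theorem theorem1p1 (R : realType) (p : {poly Cplx R}) (hp : (2 < size p)%N) :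
  mx_julia p = boundary (closure (mx_filled_julia p)) /\
  boundary (closure (mx_filled_julia p)) =
    mx_julia_diag p `|` mx_julia_jordan p.
Proof.
have [rho rho1 rhoP] := escape_radius hp.
rewrite (mx_juliaE rho1 rhoP hp) (boundary_closure_mx_filled_julia rho1 rhoP hp).
split=> //; rewrite interior_eig_in.
have jE z := juliaE rho1 rhoP z.
apply/seteqP; split=> M.
  move=> [MK MJ]; have [Q [Qu [[a [b ME]]|[a ME]]]] := mx2_normal_form M; [left|right].
    have eig c : eigenvalue M c = (c == a) || (c == b).
      by rewrite ME eigenvalue_conj// eigenvalue_diag2.
    have aK : filled_julia p a by apply: MK; rewrite eig eqxx.
    have bK : filled_julia p b by apply: MK; rewrite eig eqxx orbT.
    exists a, b, Q; split; last by split; [exact: Qu|exact: ME].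
    (* Not both eigenvalues are interior to [K_p]; the case distinction decides which factor of the
       product carries [J_p]. *)
    have [ai|ai] := pselect ((filled_julia p)^° a); last by right; split => //; apply/jE.
    left; split => //; apply/jE; split=> // bi; apply: MJ => c.
    by rewrite eig => /orP[/eqP->|/eqP->].
  have eig c : eigenvalue M c = (c == a) by rewrite ME eigenvalue_conj// eigenvalue_jordan2.
  exists a, Q; split; last by split; [exact: Qu|exact: ME].
  apply/jE; split; first by apply: MK; rewrite eig eqxx.
  by move=> ai; apply: MJ => c; rewrite eig => /eqP->.
move=> [[a [b [Q [abJ [Qu ->]]]]]|[a [Q [/jE[aK ai] [Qu ->]]]]].
  have [aK bK ab] : [/\ filled_julia p a, filled_julia p b &
      ~ ((filled_julia p)^° a /\ (filled_julia p)^° b)].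
    case: abJ => [[aK /jE[bK bi]]|[/jE[aK ai] bK]]; split;
      [exact: aK|exact: bK| |exact: aK|exact: bK|].
      by move=> [_ bi']; exact: bi bi'.
    by move=> [ai' _]; exact: ai ai'.
  split=> [c|MJ].
    by rewrite (eigenvalue_conj _ _ Qu) eigenvalue_diag2 => /orP[/eqP->|/eqP->];
      [exact: aK|exact: bK].
  by apply: ab; split; apply: MJ; rewrite (eigenvalue_conj _ _ Qu) eigenvalue_diag2 eqxx ?orbT.
split=> [c|MJ].
  by rewrite (eigenvalue_conj _ _ Qu) eigenvalue_jordan2 => /eqP->; exact: aK.
by apply: ai; apply: MJ; rewrite (eigenvalue_conj _ _ Qu) eigenvalue_jordan2.
Qed.
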